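(* Let $G$ be a finitely generated non-amenable group acting geometrically on a proper geodesic metric space $(X,d)$ with base point $o\in X$, and let $\mu$ be an irreducible, finitely supported probability measure on $G$ with Green function $\mathcal G$. Let $\gamma$ be a $\kappa$-Morse $c$-quasi-geodesic in $X$. Then there exists a constant $C=C(\kappa,c)>0$, depending only on $\kappa$ and $c$ (and on the fixed data $G,X,o,\mu$), such that if points $xo,zo,yo$ lie on the quasi-geodesic $\gamma$ in this order for group elements $x,y,z\in G$, then $$C^{-1}\mathcal G(x,z)\mathcal G(z,y)\le\mathcal G(x,y)\le C\,\mathcal G(x,z)\mathcal G(z,y).$$
   Context: A geometric action is a proper cocompact isometric action. Irreducible means that for all $x,y\in G$ there is $n$ with $p_n(x,y):=\mu^{*n}(x^{-1}y)>0$. $\mathcal G(x,y)=\sum_{n\ge0}p_n(x,y)$, finite since $G$ is non-amenable. For $c\ge1$, a $c$-quasi-geodesic is a map $\varphi$ from an interval to $X$ with $c^{-1}|s-t|-c\le d(\varphi(s),\varphi(t))\le c|s-t|+c$ for all $s,t$. For a function $\kappa:[1,\infty)\to[0,\infty)$, a subset $Y\subset X$ is $\kappa$-Morse if for every $c'\ge1$ every $c'$-quasi-geodesic with endpoints on $Y$ lies in the $\kappa(c')$-neighborhood of $Y$; a quasi-geodesic is $\kappa$-Morse if its image is. *)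

(* Defs.v *)
From HB Require Import structures.
From mathcomp Require Import all_boot all_order all_algebra.
From mathcomp Require Import all_classical all_reals all_analysis.

Set Implicit Arguments.
Unset Strict Implicit.
Unset Printing Implicit Defensive.

Import Order.TTheory GRing.Theory Num.Theory.
Import numFieldNormedType.Exports.

Local Open Scope classical_set_scope.
Local Open Scope ring_scope.

Definition finitely_generated (G : groupType) : Prop :=
  exists2 S : set G, finite_set S &
    forall H : set G, S `<=` H -> H 1%g ->
      (forall g h, H g -> H h -> H (g * h)%g) ->
      (forall g, H g -> H g^-1%g) -> H = setT.

(* A left-invariant finitely additive probability measure on all subsets. *)
Definition invariant_mean (R : realType) (G : groupType) (m : set G -> R) :
    Prop :=
  [/\ forall A, 0 <= m A,
      m setT = 1,
      forall A B, A `&` B = set0 -> m (A `|` B) = m A + m B &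
      forall g A, m [set (g * a)%g | a in A] = m A].

Definition amenable (R : realType) (G : groupType) : Prop :=
  exists m : set G -> R, invariant_mean m.

(* Stated on {y | d(x,y) <= r} itself: the library's closed_ball is the closure
   of the open ball, which may be smaller. *)
Definition proper_space (R : realType) (X : metricType R) : Prop :=
  forall (x : X) (r : R), compact [set y | mdist x y <= r].

Definition geodesic_space (R : realType) (X : metricType R) : Prop :=
  forall x y : X, exists phi : R -> X,
    [/\ phi 0 = x, phi (mdist x y) = y &
        forall s t, s \in `[0, mdist x y] -> t \in `[0, mdist x y] ->
          mdist (phi s) (phi t) = `|s - t|].

Definition group_action (G : groupType) (X : Type) (act : G -> X -> X) : Prop :=
  (forall p, act 1%g p = p) /\
  (forall g h p, act (g * h)%g p = act g (act h p)).

Definition isometric_action (R : realType) (G : groupType) (X : metricType R)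
    (act : G -> X -> X) : Prop :=
  forall g p q, mdist (act g p) (act g q) = mdist p q.

Definition proper_action (R : realType) (G : groupType) (X : metricType R)
    (act : G -> X -> X) : Prop :=
  forall K : set X, compact K ->
    finite_set [set g | (act g @` K) `&` K !=set0].

Definition cocompact_action (R : realType) (G : groupType) (X : metricType R)
    (act : G -> X -> X) : Prop :=
  exists2 K : set X, compact K & \bigcup_(g : G) (act g @` K) = setT.

Definition geometric_action (R : realType) (G : groupType) (X : metricType R)
    (act : G -> X -> X) : Prop :=
  [/\ group_action act, isometric_action act, proper_action act &
      cocompact_action act].

(* The sums over G below are finite-support sums (0 by convention when the
   support is infinite); they are used for finitely supported functions only. *)
Definition fsupp_probability (R : realType) (G : groupType) (mu : G -> R) :
    Prop :=
  [/\ forall g, 0 <= mu g,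
      finite_set [set g | mu g != 0] &
      \sum_(g \in [set: G]) mu g = 1].

Definition convolution (R : realType) (G : groupType) (f h : G -> R) (g : G) :
    R :=
  \sum_(k \in [set: G]) f k * h (k^-1 * g)%g.

Definition convolution_power (R : realType) (G : groupType) (mu : G -> R)
    (n : nat) : G -> R :=
  iter n (convolution mu) (fun g => (g == 1%g)%:R).

Definition transition (R : realType) (G : groupType) (mu : G -> R) (n : nat)
    (x y : G) : R :=
  convolution_power mu n (x^-1 * y)%g.

Definition irreducible (R : realType) (G : groupType) (mu : G -> R) : Prop :=
  forall x y : G, exists n : nat, 0 < transition mu n x y.

Definition green (R : realType) (G : groupType) (mu : G -> R) (x y : G) :
    \bar R :=
  (\sum_(0 <= n <oo) (transition mu n x y)%:E)%E.

(* A map defined on the interval I is a total function considered on I only. *)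
Definition quasi_geodesic (R : realType) (X : metricType R) (c : R)
    (I : set R) (phi : R -> X) : Prop :=
  is_interval I /\
  forall s t, I s -> I t ->
    c^-1 * `|s - t| - c <= mdist (phi s) (phi t) <= c * `|s - t| + c.

(* The closed r-neighborhood {p | d(p,Y) <= r}, d(p,Y) being an infimum. *)
Definition neighborhood (R : realType) (X : metricType R) (Y : set X) (r : R) :
    set X :=
  [set p | (ereal_inf [set (mdist p q)%:E | q in Y] <= r%:E)%E].

Definition morse_set (R : realType) (X : metricType R) (kappa : R -> R)
    (Y : set X) : Prop :=
  forall c' : R, 1 <= c' ->
  forall (a b : R) (phi : R -> X), a <= b ->
    quasi_geodesic c' `[a, b]%classic phi -> Y (phi a) -> Y (phi b) ->
    phi @` `[a, b]%classic `<=` neighborhood Y (kappa c').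

(* Main.v *)
(* Let l(g) be the rounded distance from o to g o and rho(p) = l(z^-1 p).

   Non-amenability gives p_n <= A t^n with t < 1: otherwise the normalized squares
   of almost invariant l^2 vectors converge along an ultrafilter to an invariant
   mean. As mu may be periodic, the gap is obtained for the lazy walk and passes to
   mu by comparing binomial weights.

   A trajectory from x to y is tame if j - i <= K (rho(w_i) + rho(w_j)) for all
   i <= j. A tame trajectory meets a ball around z of radius depending on K, kappa
   and c only: a chain of minimal cost, for a cost which favours the steps of the
   trajectory, is a quasi-geodesic staying at least half as far from z as the
   trajectory; by the Morse property it follows gamma and so crosses near z.

   A trajectory which is not tame spends a time at least K (rho(a) + rho(b)) between
   some a and b. For K large this is exponentially unlikely compared with
   G(a, b) >= q^(rho(a) + rho(b)), and G(x,a) G(a,b) G(b,y) <= G(e,e)^2 G(x,y), so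
   that trajectories avoiding a large ball around z carry at most half of G(x,y);
   the others are bounded by G(x,z) G(z,y). *)

Require Import Defs.
From HB Require Import structures.
From mathcomp Require Import all_boot all_order all_algebra.
From mathcomp Require Import finmap.
From mathcomp Require Import all_classical all_reals all_analysis.
From mathcomp Require Import zify ring lra.

Set Implicit Arguments.
Unset Strict Implicit.
Unset Printing Implicit Defensive.

Import Order.TTheory GRing.Theory Num.Theory.
Import numFieldNormedType.Exports.

Local Open Scope classical_set_scope.
Local Open Scope ring_scope.

(** * Sums of finitely supported functions *)

Section FinSupp.
Variables (R : realType) (G : groupType).
Implicit Types (f h : G -> R) (D : {fset G}).

Definition fsupp f := finite_set [set g | f g != 0].

Definition gsum f : R := \sum_(g \in [set: G]) f g.

Lemma gsumE D f : (forall g, g \notin D -> f g = 0) -> gsum f = \sum_(g <- D) f g.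
Proof. exact: fsbigTE. Qed.

Lemma fsupp_fset f : fsupp f -> exists D, forall g, g \notin D -> f g = 0.
Proof.
move=> ff; exists (fset_set [set g | f g != 0]) => g.
rewrite in_fset_set// => gD; apply/eqP/negPn/negP => fg.
by move/negP: gD; apply; rewrite inE.
Qed.

Lemma fset_fsupp D f : (forall g, g \notin D -> f g = 0) -> fsupp f.
Proof.
move=> fD; apply: (finite_subfset D) => g /= fg.
by apply: contraNT fg => /fD ->.
Qed.

Lemma fsupp0 f h : fsupp f -> (forall g, f g = 0 -> h g = 0) -> fsupp h.
Proof. by move=> /fsupp_fset[D fD] fh; apply: (@fset_fsupp D) => g /fD/fh. Qed.

Lemma fsuppD f h : fsupp f -> fsupp h -> fsupp (fun g => f g + h g).
Proof.
move=> /fsupp_fset[D fD] /fsupp_fset[D' fD'].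
apply: (@fset_fsupp (D `|` D')%fset) => g; rewrite in_fsetU negb_or.
by move=> /andP[/fD -> /fD' ->]; rewrite addr0.
Qed.

Lemma fsupp_sum (I : Type) (r : seq I) (F : I -> G -> R) :
  (forall i, fsupp (F i)) -> fsupp (fun g => \sum_(i <- r) F i g).
Proof.
move=> FF; elim: r => [|i r ih].
  by apply: (@fset_fsupp fset0) => g _; rewrite big_nil.
apply: (fsupp0 (fsuppD (FF i) ih)) => g.
by rewrite big_cons.
Qed.

Lemma fsupp_lmul (a : G) f : fsupp f -> fsupp (fun g => f (a * g)%g).
Proof.
move=> /fsupp_fset[D fD].
apply: (@fset_fsupp [fset (a^-1 * g)%g | g in D]%fset) => g gD.
apply: fD; apply: contra gD => gD; apply/imfsetP; exists (a * g)%g => //.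
by rewrite mulKg.
Qed.

Lemma gsum_lmul (a : G) f : gsum (fun g => f (a * g)%g) = gsum f.
Proof.
rewrite /gsum [RHS](reindex_fsbigT (fun g => a * g)%g)//.
by exists (fun g => a^-1 * g)%g => g; rewrite ?mulKg ?mulVKg.
Qed.

Lemma gsum_ge0 f : (forall g, 0 <= f g) -> 0 <= gsum f.
Proof. by move=> f0; apply: fsumr_ge0. Qed.

Lemma gsumZ a f : gsum (fun g => a * f g) = a * gsum f.
Proof. by rewrite /gsum mulr_fsumr. Qed.

Lemma gsumD f h : fsupp f -> fsupp h -> gsum (fun g => f g + h g) = gsum f + gsum h.
Proof.
move=> /fsupp_fset[D fD] /fsupp_fset[D' fD'].
have E k : (forall g, f g = 0 -> h g = 0 -> k g = 0) ->
    gsum k = \sum_(g <- (D `|` D')%fset) k g.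
  move=> k0; apply: gsumE => g; rewrite in_fsetU negb_or => /andP[gD gD'].
  by apply: k0; [apply: fD|apply: fD'].
rewrite (E _)//; last by move=> g -> ->; rewrite addr0.
by rewrite [gsum f]E// [gsum h]E// -big_split.
Qed.

Lemma gsum_sum (I : Type) (r : seq I) (F : I -> G -> R) :
  (forall i, fsupp (F i)) ->
  gsum (fun g => \sum_(i <- r) F i g) = \sum_(i <- r) gsum (F i).
Proof.
move=> FF; elim: r => [|i r ih].
  by rewrite big_nil /gsum fsbig1// => g _; rewrite big_nil.
rewrite big_cons -ih -gsumD//; last exact: fsupp_sum.
by congr gsum; apply/funext => g; rewrite big_cons.
Qed.

Lemma ler_gsum f h : fsupp f -> fsupp h -> (forall g, f g <= h g) -> gsum f <= gsum h.
Proof.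
move=> ff fh fleh; rewrite -subr_ge0 -mulN1r -gsumZ -gsumD//.
  by apply: gsum_ge0 => g; rewrite mulN1r subr_ge0.
by apply: (fsupp0 ff) => g ->; rewrite mulr0.
Qed.

Lemma gsum_ge f a : fsupp f -> (forall g, 0 <= f g) -> f a <= gsum f.
Proof.
move=> /fsupp_fset[D fD] f0.
have [aD|/fD ->] := boolP (a \in D); last exact: gsum_ge0.
by rewrite (gsumE fD) (big_fsetD1 a)//= lerDl sumr_ge0.
Qed.

End FinSupp.

(** * Almost invariant vectors and invariant means *)

(** The image of an ultrafilter is again an ultrafilter, and ultrafilters on the compact interval
    [0, 1] converge. *)
Lemma ultra_cvg (R : realType) (T : Type) (U : set_system T) (u : T -> R) :
  UltraFilter U -> (forall t, 0 <= u t <= 1) -> exists l : R, u @ U --> l.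
Proof.
move=> UU u01.
have := @segment_compact R 0 1; rewrite compact_ultra => /(_ (u @ U)) [].
- split; first exact: fmap_proper_filter.
  move=> F FF uF; apply/seteqP; split; last exact: uF.
  move=> A FA; rewrite /fmap/=.
  have [//|UA] := in_ultra_setVsetC (u @^-1` A) UU.
  have : F (~` A) by apply: uF.
  move=> /(filterI FA); rewrite setICr => F0; exfalso; exact: (@filter_not_empty _ F).
- by apply: (@filterE _ U) => t /=; rewrite in_itv/=; exact: u01.
- by move=> l [_ ul]; exists l.
Qed.

Section Mean.
Variables (R : realType) (G : groupType) (mu : G -> R) (S : seq G).
Hypothesis mu_ge0 : forall g, 0 <= mu g.

(** When the weights sum to 1 this is twice the quadratic form of I - P, where P is convolution by
    [mu]; symmetry of [mu] is not assumed. *)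
Definition energy (f : G -> R) : R :=
  \sum_(s <- S) mu s * gsum (fun g => (f (s^-1 * g)%g - f g) ^+ 2).

Let mass (f : G -> R) (B : set G) : R :=
  gsum (fun g => \1_B g * f g ^+ 2) / gsum (fun g => f g ^+ 2).

(** Pointwise, b^2 - a^2 = (b - a)(b + a) is split by the arithmetic-geometric inequality with
    weight [t], then summed over the group. The free parameter [t] is later matched to the size of
    the energy. *)
Lemma gsum_shift_le (f : G -> R) (w : G -> R) (s : G) (t : R) :
  fsupp f -> (forall g, 0 <= w g <= 1) -> 0 < t ->
  `|gsum (fun g => w g * f (s * g)%g ^+ 2) - gsum (fun g => w g * f g ^+ 2)| <=
  t * gsum (fun g => (f (s^-1 * g)%g - f g) ^+ 2)
    + 2 / t * gsum (fun g => f g ^+ 2).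
Proof.
move=> ff w01 t0.
have fs := fsupp_lmul s ff.
have f2 : fsupp (fun g => f g ^+ 2) by apply: (fsupp0 ff) => g ->; rewrite expr0n.
have fs2 : fsupp (fun g => f (s * g)%g ^+ 2).
  by apply: (fsupp0 fs) => g ->; rewrite expr0n.
have d2 : fsupp (fun g => (f g - f (s * g)%g) ^+ 2).
  apply: (fsupp0 (fsuppD f2 fs2)) => g /eqP.
  rewrite paddr_eq0 ?sqr_ge0// !sqrf_eq0 => /andP[/eqP -> /eqP ->].
  by rewrite subr0 expr0n.
have -> : gsum (fun g => (f (s^-1 * g)%g - f g) ^+ 2) =
    gsum (fun g => (f g - f (s * g)%g) ^+ 2).
  by rewrite -[LHS](gsum_lmul s); congr gsum; apply/funext => g; rewrite mulKg.
have -> : 2 / t * gsum (fun g => f g ^+ 2) =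
    t^-1 * gsum (fun g => f g ^+ 2 + f (s * g)%g ^+ 2).
  rewrite gsumD// (gsum_lmul s (fun g => f g ^+ 2)); lra.
have td2 : fsupp (fun g => t * (f g - f (s * g)%g) ^+ 2).
  by apply: (fsupp0 d2) => g ->; rewrite mulr0.
have tf2 : fsupp (fun g => t^-1 * (f g ^+ 2 + f (s * g)%g ^+ 2)).
  by apply: (fsupp0 (fsuppD f2 fs2)) => g ->; rewrite mulr0.
have wf2 : fsupp (fun g => -1 * (w g * f g ^+ 2)).
  by apply: (fsupp0 f2) => g ->; rewrite !mulr0.
have wfs2 : fsupp (fun g => w g * f (s * g)%g ^+ 2).
  by apply: (fsupp0 fs2) => g ->; rewrite !mulr0.
rewrite -!gsumZ -gsumD// -mulN1r -gsumZ -gsumD//.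
have key (a b v : R) : 0 <= v <= 1 ->
    `|v * b ^+ 2 + -1 * (v * a ^+ 2)| <= t * (a - b) ^+ 2 + t^-1 * (a ^+ 2 + b ^+ 2).
  move=> /andP[v0 v1]; have u0 : 0 < t^-1 by rewrite invr_gt0.
  have tu : t * t^-1 = 1 by rewrite divff// gt_eqF.
  set u := t^-1 in u0 tu *.
  have -> : v * b ^+ 2 + -1 * (v * a ^+ 2) = v * (b ^+ 2 - a ^+ 2) by ring.
  rewrite normrM ger0_norm//; apply: (@le_trans _ _ `|b ^+ 2 - a ^+ 2|).
    by rewrite ler_piMl.
  (* The two completed squares [h1] and [h2] give the upper and the lower bound on b^2 - a^2. *)
  have h1 : 0 <= u * (t * (a - b) + (a + b)) ^+ 2 by rewrite mulr_ge0 ?sqr_ge0 ?ltW.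
  have h2 : 0 <= u * (t * (a - b) - (a + b)) ^+ 2 by rewrite mulr_ge0 ?sqr_ge0 ?ltW.
  have h3 : 0 <= u * (a - b) ^+ 2 by rewrite mulr_ge0 ?sqr_ge0 ?ltW.
  have h4 : 0 <= t * (a - b) ^+ 2 by rewrite mulr_ge0 ?sqr_ge0 ?ltW.
  have e1 : u * (t * (a - b) + (a + b)) ^+ 2 =
     (t * u) * (t * (a - b) ^+ 2 + 2 * (a ^+ 2 - b ^+ 2)) + u * (a + b) ^+ 2 by ring.
  have e2 : u * (t * (a - b) - (a + b)) ^+ 2 =
     (t * u) * (t * (a - b) ^+ 2 - 2 * (a ^+ 2 - b ^+ 2)) + u * (a + b) ^+ 2 by ring.
  have e3 : u * (a + b) ^+ 2 = 2 * (u * (a ^+ 2 + b ^+ 2)) - u * (a - b) ^+ 2 by ring.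
  rewrite e1 tu e3 mul1r in h1; rewrite e2 tu e3 mul1r in h2.
  rewrite ler_norml; apply/andP; split; lra.
have h g := key (f g) (f (s * g)%g) (w g) (w01 g).
rewrite ler_norml; apply/andP; split; last first.
  apply: ler_gsum (fsuppD wfs2 wf2) (fsuppD td2 tf2) _ => g.
  by have := h g; rewrite ler_norml => /andP[].
rewrite lerNl -[- gsum _]mulN1r -gsumZ.
apply: ler_gsum; [|exact: (fsuppD td2 tf2)|move=> g].
  by apply: (fsupp0 (fsuppD wfs2 wf2)) => g ->; rewrite mulr0.
by have := h g; rewrite ler_norml => /andP[h1 _]; rewrite mulN1r lerNl.
Qed.

(** The densities f_n^2 / |f_n|^2 define finitely additive probabilities [mass (f n)]; their limit
    along a free ultrafilter is invariant under each s of positive weight, hence under the group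
    that these elements generate. *)
Lemma amenable_of_energy :
  (forall H : set G, H 1%g -> (forall g h, H g -> H h -> H (g * h)%g) ->
     (forall g, H g -> H g^-1%g) -> (forall s, s \in S -> 0 < mu s -> H s) ->
     H = setT) ->
  (forall n : nat, exists f : G -> R, [/\ fsupp f, 0 < gsum (fun g => f g ^+ 2) &
     n.+1%:R ^+ 2 * energy f <= gsum (fun g => f g ^+ 2)]) ->
  amenable R G.
Proof.
move=> gen /choice[f Hf].
have f_fs n : fsupp (f n) by case: (Hf n).
have f2_fs n : fsupp (fun g => f n g ^+ 2).
  by apply: (fsupp0 (f_fs n)) => g ->; rewrite expr0n.
have f2_gt0 n : 0 < gsum (fun g => f n g ^+ 2) by case: (Hf n).
have fB_fs n (w : G -> R) : fsupp (fun g => w g * f n g ^+ 2).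
  by apply: (fsupp0 (f_fs n)) => g ->; rewrite expr0n mulr0.
have mass01 n B : 0 <= mass (f n) B <= 1.
  apply/andP; split.
    by rewrite divr_ge0// ?(ltW (f2_gt0 n))// gsum_ge0// => g;
      rewrite mulr_ge0// sqr_ge0.
  rewrite ler_pdivrMr// mul1r; apply: ler_gsum (fB_fs n _) (f2_fs n) _ => g.
  by rewrite ler_piMl// ?sqr_ge0// indicE lern1 leq_b1.
have [U [UU ooU]] := @ultraFilterLemma nat \oo _.
have /choice[m Hm] B : exists l : R, (fun n => mass (f n) B) @ U --> l.
  exact: ultra_cvg.
have mE B l : (fun n => mass (f n) B) @ U --> l -> m B = l.
  by move=> /(cvg_unique _ (Hm B)); apply; exact: norm_hausdorff.
have m_inv1 s : s \in S -> 0 < mu s -> forall B, m [set (s * a)%g | a in B] = m B.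
  move=> sS mus B.
  suff : (fun n => mass (f n) [set (s * a)%g | a in B] - mass (f n) B) @ U --> (0 : R).
    move=> h0; apply: mE; rewrite -[m B]add0r.
    have -> : (fun n => mass (f n) [set (s * a)%g | a in B]) =
      (fun n => (mass (f n) [set (s * a)%g | a in B] - mass (f n) B) + mass (f n) B).
      by apply/funext => n; rewrite subrK.
    exact: cvgD h0 (Hm B).
  (* By [gsum_shift_le] with t = n + 1 the two masses differ by at most c / (n + 1): the energy
     dominates its s-term and is at most |f_n|^2 / (n + 1)^2. *)
  pose c := (mu s)^-1 + 2.
  apply: (@cvg_trans _
    ((fun n => mass (f n) [set (s * a)%g | a in B] - mass (f n) B) @ \oo)).
    by move=> A; apply: ooU.
  apply/norm_cvg0P; apply: (@squeeze_cvgr _ _ _ _ (fun=> 0) (fun n => c * harmonic n)).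
  - apply: nearW => n /=; rewrite normr_ge0/= -mulrBl normrM normfV.
    rewrite (gtr0_norm (f2_gt0 n)) ler_pdivrMr//.
    have -> : gsum (fun g => \1_[set (s * a)%g | a in B] g * f n g ^+ 2) =
       gsum (fun g => \1_B g * f n (s * g)%g ^+ 2).
      rewrite -[LHS](gsum_lmul s); congr gsum; apply/funext => g; congr (_ * _).
      rewrite !indicE; congr ((nat_of_bool _)%:R); apply/idP/idP; rewrite !inE.
        by move=> [a Ba /mulgI <-].
      by move=> Bg; exists g.
    apply: le_trans (gsum_shift_le s (f_fs n) _ (ltr0Sn R n)) _.
      by move=> g; rewrite indicE; case: (_ \in _); rewrite /= ?lexx ?ler01.
    have [_ _ En] := Hf n.
    set q := gsum (fun g => f n g ^+ 2) in En *.
    set d := gsum (fun g => _).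
    have dE : mu s * d <= energy (f n).
      rewrite /energy (big_rem s)//= lerDl sumr_ge0// => i _.
      by rewrite mulr_ge0// gsum_ge0// => g; exact: sqr_ge0.
    rewrite /c /harmonic /=; set t := n.+1%:R in En *.
    have t0 : 0 < t by rewrite ltr0Sn.
    have -> : t * d = (mu s)^-1 * t^-1 * (t ^+ 2 * (mu s * d)).
      by field; rewrite !gt_eqF.
    have -> : ((mu s)^-1 + 2) / t * q = (mu s)^-1 * t^-1 * q + 2 / t * q by ring.
    rewrite lerD2r ler_wpM2l//; first by rewrite mulr_ge0 ?invr_ge0 ?ltW.
    by apply: le_trans En; rewrite ler_wpM2l// sqr_ge0.
  - exact: cvg_cst.
  - rewrite -(mulr0 c); apply: cvgMr; exact: cvg_harmonic.
(* The elements preserving the limit form a subgroup containing the support. *)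
have Hsub : [set g | forall B, m [set (g * a)%g | a in B] = m B] = setT.
  apply: gen => //=.
  - by move=> B; congr m; apply/seteqP; split => [g [a Ba <-]|g Bg];
    rewrite ?mul1g//; exists g; rewrite ?mul1g.
  - move=> g h Hg Hh B; rewrite -[RHS]Hh -[RHS]Hg; congr m.
    by rewrite image_comp; apply: eq_imagel => a _ /=; rewrite mulgA.
  - move=> g Hg B; rewrite -[LHS]Hg; congr m.
    rewrite image_comp -[RHS]image_id; apply: eq_imagel => a _ /=; exact: mulVKg.
exists m; split.
- by move=> A; apply: (cvgr_to_ge (Hm A)); apply: nearW => n; case/andP: (mass01 n A).
- apply: mE; rewrite (_ : (fun n => _) = fun=> 1); first exact: cvg_cst.
  apply/funext => n; rewrite /mass.
  have -> : (fun g => \1_setT g * f n g ^+ 2) = (fun g => f n g ^+ 2).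
    by apply/funext => g; rewrite indicE in_setT mul1r.
  by rewrite divff// gt_eqF.
- move=> A B AB0; apply: mE;
  rewrite (_ : (fun n => _) = fun n => mass (f n) A + mass (f n) B).
    exact: cvgD (Hm A) (Hm B).
  apply/funext => n; rewrite /mass -mulrDl -gsumD//; congr (gsum _ / _).
  apply/funext => g; rewrite -mulrDl; congr (_ * _).
  rewrite !indicE in_setU -natrD; congr (_%:R).
  have : ~ (A g /\ B g) by move=> [Ag Bg]; have : (A `&` B) g by []; rewrite AB0.
  case: (boolP (g \in A)); case: (boolP (g \in B)) => //=.
  by move=> /set_mem Bg /set_mem Ag; case.
- move=> g A; have : [set g | forall B, m [set (g * a)%g | a in B] = m B] g
  by rewrite Hsub.
  exact.
Qed.
End Mean.

(** * Exponential decay of convolution powers *)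

(** Induction through (k + 1) C(2k + 2, k + 1) = 2 (2k + 1) C(2k, k). This bounds the loss when the
    lazy walk at time 2k is compared with the original walk at time k. *)
Lemma central_bin_ge k : (4 ^ k <= (2 * k).+1 * 'C(2 * k, k))%N.
Proof.
elim: k => [//|k ih].
have e1 : ((2 * k).+2 * 'C((2 * k).+1, k) = k.+1 * 'C((2 * k).+2, k.+1))%N.
  exact: mul_bin_diag (2 * k).+2 k.
have e2 : ((2 * k).+1 * 'C(2 * k, k) = k.+1 * 'C((2 * k).+1, k))%N.
  have := mul_bin_down (2 * k).+1 k.
  rewrite /= => ->; congr (_ * _)%N; lia.
have e3 : ((2 * k).+2 = 2 * k.+1)%N by lia.
rewrite e3 in e1; rewrite expnS.
have e4 : (k.+1 * 'C(2 * k.+1, k.+1) = 2 * ((2 * k).+1 * 'C(2 * k, k)))%N.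
  by rewrite -e1 e2 mulnA.
rewrite -(leq_pmul2l (ltn0Sn k)).
have -> : (k.+1 * ((2 * k.+1).+1 * 'C(2 * k.+1, k.+1)) =
  (2 * k.+1).+1 * (k.+1 * 'C(2 * k.+1, k.+1)))%N by lia.
rewrite e4; nia.
Qed.

(** With t the square root of r, r^n = t^n t^n, and Bernoulli's inequality for t^-1 = 1 + e lets one
    factor t^n absorb the linear term. *)
Lemma linear_geometric_bound (R : realType) (r : R) : 0 < r -> r < 1 ->
  exists A t : R, [/\ 0 < A, 0 < t, t < 1 &
    forall n, (2 * n).+1%:R * r ^+ n <= A * t ^+ n].
Proof.
move=> r0 r1; pose t := Num.sqrt r.
have t0 : 0 < t by rewrite sqrtr_gt0.
have t1 : t < 1 by rewrite -sqrtr1 ltr_sqrt.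
have tt : t * t = r by rewrite -expr2 sqr_sqrtr// ltW.
pose e := t^-1 - 1; have e0 : 0 < e by rewrite subr_gt0 invf_gt1.
exists (1 + 2 / e), t; split=> //; first by rewrite addr_gt0// divr_gt0.
move=> n; rewrite -tt exprMn mulrA ler_wpM2r//; first by rewrite exprn_ge0// ltW.
have bern : 1 + n%:R * e <= t ^- n.
  rewrite -exprVn; have -> : t^-1 = 1 + e by rewrite /e addrC subrK.
  elim: n => [|n ih]; first by rewrite mul0r addr0 expr0.
  rewrite exprS; apply: (@le_trans _ _ ((1 + e) * (1 + n%:R * e))); last first.
    by rewrite ler_wpM2l// ltW// addr_gt0.
  have := mulr_ge0 (ler0n R n) (sqr_ge0 e); rewrite -(natr1 n); lra.
rewrite -ler_pdivlMr ?exprn_gt0//.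
apply: (@le_trans _ _ ((1 + 2 / e) * (1 + n%:R * e))); last first.
  by rewrite ler_wpM2l// ltW// addr_gt0// divr_gt0.
have -> : (1 + 2 / e) * (1 + n%:R * e) = 1 + n%:R * e + 2 / e + 2 * n%:R.
  by field; rewrite gt_eqF.
have := mulr_ge0 (ler0n R n) (ltW e0).
have : 0 < 2 / e by rewrite divr_gt0.
rewrite -[(2 * n).+1]add1n natrD natrM; lra.
Qed.

(** * Contraction of the lazy walk in l^2 *)

Section Kesten.
Variables (R : realType) (G : groupType) (mu : G -> R) (S : seq G).
Hypothesis mu_ge0 : forall g, 0 <= mu g.
Hypothesis mu_sum : \sum_(s <- S) mu s = 1.

Definition conv_step (f : G -> R) (g : G) : R := \sum_(s <- S) mu s * f (s^-1 * g)%g.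

Definition lazy_step (f : G -> R) (g : G) : R := (f g + conv_step f g) / 2.

(** Expand the variance of [v], which is nonnegative. *)
Lemma jensen_sqr (v : G -> R) :
  (\sum_(s <- S) mu s * v s) ^+ 2 <= \sum_(s <- S) mu s * v s ^+ 2.
Proof.
set m := \sum_(s <- S) mu s * v s.
have : 0 <= \sum_(s <- S) mu s * (v s - m) ^+ 2.
  by apply: sumr_ge0 => s _; rewrite mulr_ge0// sqr_ge0.
have -> : \sum_(s <- S) mu s * (v s - m) ^+ 2 =
  \sum_(s <- S) mu s * v s ^+ 2 - 2 * m * m + m ^+ 2 * 1.
  rewrite (eq_bigr (fun s =>
    mu s * v s ^+ 2 + - (2 * m) * (mu s * v s) + m ^+ 2 * mu s)).
    by rewrite !big_split -!mulr_sumr/= mu_sum -/m mulNr.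
  by move=> s _; ring.
lra.
Qed.

Lemma fsupp_conv f : fsupp f -> fsupp (conv_step f).
Proof.
move=> ff; apply: fsupp_sum => s; apply: (fsupp0 (fsupp_lmul s^-1%g ff)) => g ->.
exact: mulr0.
Qed.

Lemma fsupp_lazy f : fsupp f -> fsupp (lazy_step f).
Proof.
move=> ff; apply: (fsupp0 (fsuppD ff (fsupp_conv ff))) => g.
by rewrite /lazy_step => ->; rewrite mul0r.
Qed.

(** The lazy step averages the midpoints of f(g) and f(s^-1 g). Jensen's inequality bounds its
    square by the average of the squared midpoints, and the parallelogram identity ((a + b)/2)^2 =
    (a^2 + b^2)/2 - (b - a)^2/4 produces the energy. *)
Lemma lazy_step_sqr f : fsupp f ->
  gsum (fun g => lazy_step f g ^+ 2) <= gsum (fun g => f g ^+ 2) - energy mu S f / 4.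
Proof.
move=> ff.
have f2 (h : G -> R) : fsupp h -> fsupp (fun g => h g ^+ 2).
  by move=> fh; apply: (fsupp0 fh) => g ->; rewrite expr0n.
pose F s g := mu s * ((f g ^+ 2 + f (s^-1 * g)%g ^+ 2) / 2
   - (f (s^-1 * g)%g - f g) ^+ 2 / 4).
have ft s := fsupp_lmul s^-1%g ff.
have fd s : fsupp (fun g => f (s^-1 * g)%g - f g).
  by apply: fsuppD => //; apply: (fsupp0 ff) => g ->; rewrite oppr0.
have fF1 s : fsupp (fun g => mu s / 2 * f g ^+ 2).
  by apply: (fsupp0 (f2 _ ff)) => g ->; rewrite mulr0.
have fF2 s : fsupp (fun g => mu s / 2 * f (s^-1 * g)%g ^+ 2).
  by apply: (fsupp0 (f2 _ (ft s))) => g ->; rewrite mulr0.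
have fF3 s : fsupp (fun g => - mu s / 4 * (f (s^-1 * g)%g - f g) ^+ 2).
  by apply: (fsupp0 (f2 _ (fd s))) => g ->; rewrite mulr0.
have FE s : F s = (fun g => (mu s / 2 * f g ^+ 2 + mu s / 2 * f (s^-1 * g)%g ^+ 2)
    + - mu s / 4 * (f (s^-1 * g)%g - f g) ^+ 2).
  by apply/funext => g; rewrite /F; lra.
have fF s : fsupp (F s) by rewrite FE; apply: (fsuppD (fsuppD (fF1 s) (fF2 s)) (fF3 s)).
apply: (@le_trans _ _ (gsum (fun g => \sum_(s <- S) F s g))).
  apply: ler_gsum (f2 _ (fsupp_lazy ff)) (fsupp_sum _ fF) _ => g.
  have -> : lazy_step f g = \sum_(s <- S) mu s * ((f g + f (s^-1 * g)%g) / 2).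
    rewrite /lazy_step -[X in (X + _) / _]mul1r -mu_sum
      mulr_suml -big_split/= mulr_suml.
    by apply: eq_bigr => s _; ring.
  apply: le_trans (jensen_sqr _) _; apply: ler_sum => s _.
  by rewrite /F ler_wpM2l//; lra.
rewrite gsum_sum// (eq_bigr (fun s => mu s * gsum (fun g => f g ^+ 2)
   - mu s * gsum (fun g => (f (s^-1 * g)%g - f g) ^+ 2) / 4)).
  by rewrite sumrB -mulr_suml mu_sum mul1r /energy mulr_suml.
move=> s _; rewrite FE (gsumD (fsuppD (fF1 s) (fF2 s)) (fF3 s)) (gsumD (fF1 s) (fF2 s)).
rewrite !gsumZ (gsum_lmul s^-1%g (fun g => f g ^+ 2)); lra.
Qed.

Let dirac1 (g : G) : R := (g == 1%g)%:R.

Lemma fsupp_dirac1 : fsupp dirac1.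
Proof.
apply: (@fset_fsupp _ _ [fset 1%g]%fset) => g; rewrite in_fset1 /dirac1 => /negbTE ->.
by [].
Qed.

(** The left side is one term of the binomial expansion of (I + P)^n applied to the Dirac mass, and
    all terms are nonnegative. The induction follows Pascal's rule. *)
Lemma lazy_ge_conv n k g :
  'C(n, k)%:R * iter k conv_step dirac1 g <= 2 ^+ n * iter n lazy_step dirac1 g.
Proof.
have conv_ge0 m h : 0 <= iter m conv_step dirac1 h.
  elim: m h => [|m ih] h /=; first by rewrite ler0n.
  by apply: sumr_ge0 => s _; rewrite mulr_ge0.
have conv_le f f' h : (forall x, f x <= f' x) -> conv_step f h <= conv_step f' h.
  by move=> ff'; apply: ler_sum => s _; rewrite ler_wpM2l.
have convZ a f h : conv_step (fun x => a * f x) h = a * conv_step f h.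
  by rewrite /conv_step mulr_sumr; apply: eq_bigr => s _; rewrite mulrCA.
elim: n k g => [|n ih] k g.
  case: k => [|k]; first by rewrite bin0 !mul1r.
  by rewrite bin0n mul0r mul1r ler0n.
have -> : 2 ^+ n.+1 * iter n.+1 lazy_step dirac1 g =
   2 ^+ n * iter n lazy_step dirac1 g +
   conv_step (fun x => 2 ^+ n * iter n lazy_step dirac1 x) g.
  by rewrite convZ exprS /= /lazy_step; field.
case: k => [|k].
  apply: ler_wpDr; last by have := ih 0%N g; rewrite !bin0.
  apply: le_trans (conv_le _ _ g (ih 0%N)).
  by apply: sumr_ge0 => s _; rewrite mulr_ge0// bin0 mul1r.
rewrite binS natrD mulrDl; apply: lerD; first exact: ih.
rewrite iterS -convZ; exact: conv_le.
Qed.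

(** The gap makes each lazy step shrink the squared norm by r = 1 - d/4, so the lazy walk at time 2n
    is pointwise at most r^n. Taking the central term of [lazy_ge_conv] yields p_n <= (2n + 1) r^n,
    and the linear factor is absorbed. *)
Lemma conv_decay (d : R) : 0 < d -> d <= 1 ->
  (forall f, fsupp f -> d * gsum (fun g => f g ^+ 2) <= energy mu S f) ->
  exists A t : R, [/\ 0 < A, 0 < t, t < 1 &
    forall n g, iter n conv_step dirac1 g <= A * t ^+ n].
Proof.
move=> d0 d1 gap; pose r := 1 - d / 4.
have r0 : 0 < r by rewrite /r; lra.
have r1 : r < 1 by rewrite /r; lra.
have fq n : fsupp (iter n lazy_step dirac1).
  elim: n => [|n ih] /=; [exact: fsupp_dirac1|exact: fsupp_lazy].
have q2 n : gsum (fun g => iter n lazy_step dirac1 g ^+ 2) <= r ^+ n.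
  elim: n => [|n ih] /=.
    rewrite (@gsumE _ _ [fset 1%g]%fset); last first.
      by move=> g; rewrite in_fset1 /dirac1 => /negbTE ->; rewrite expr0n.
    by rewrite big_seq_fset1 /dirac1 eqxx expr1n expr0.
  apply: le_trans (lazy_step_sqr (fq n)) _.
  rewrite exprS; apply: (@le_trans _ _
    (r * gsum (fun g => iter n lazy_step dirac1 g ^+ 2))).
    by have := gap _ (fq n); rewrite /r; lra.
  by rewrite ler_wpM2l// ltW.
have [A [t [A0 t0 t1 At]]] := linear_geometric_bound r0 r1.
exists A, t; split=> // n g; apply: le_trans (At n).
have qn : iter (2 * n) lazy_step dirac1 g <= r ^+ n.
  have [q0|q0] := lerP 0 (iter (2 * n) lazy_step dirac1 g); last first.
    by apply: le_trans (ltW q0) _; rewrite exprn_ge0// ltW.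
  rewrite -(@ler_pXn2r _ 2)// ?nnegrE// ?exprn_ge0 ?(ltW r0)//.
  rewrite -exprM (mulnC n); apply: le_trans (q2 (2 * n)%N).
  apply: (gsum_ge (f := fun g => iter (2 * n) lazy_step dirac1 g ^+ 2)).
    by apply: (fsupp0 (fq (2 * n)%N)) => h ->; rewrite expr0n.
  by move=> h; exact: sqr_ge0.
have c0 : 0 < 'C(2 * n, n)%:R :> R by rewrite ltr0n bin_gt0; lia.
rewrite -(ler_pM2l c0); apply: le_trans (lazy_ge_conv (2 * n) n g) _.
apply: (@le_trans _ _ (2 ^+ (2 * n) * r ^+ n)).
  by rewrite ler_wpM2l// exprn_ge0.
rewrite mulrA ler_wpM2r// ?exprn_ge0 ?(ltW r0)//.
have := central_bin_ge n; rewrite -(ler_nat R) natrX natrM => h.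
rewrite exprM (_ : 2 ^+ 2 = 4%:R :> R); first by rewrite mulrC.
by rewrite -natrX.
Qed.

End Kesten.

(** * Green function *)

Section Walk.
Variables (R : realType) (G : groupType) (mu : G -> R) (S : {fset G}).
Hypothesis mu_ge0 : forall g, 0 <= mu g.
Hypothesis mu_supp : forall g, g \notin S -> mu g = 0.
Hypothesis mu_sum : \sum_(s <- S) mu s = 1.

Local Notation tr := (transition mu).

Lemma transition0 x y : tr 0 x y = (x == y)%:R.
Proof. by rewrite /transition /convolution_power /= mulg_eq1 eqg_inv. Qed.

Lemma convolution_powerE n g :
  convolution_power mu n g = iter n (conv_step mu S) (fun g => (g == 1%g)%:R) g.
Proof.
elim: n g => [//|n ih] g.
rewrite /convolution_power !iterS /convolution (fsbigTE S) => [|h /mu_supp ->].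
  by apply: eq_bigr => s _; rewrite -ih.
by rewrite mul0r.
Qed.

Lemma transitionS n x y : tr n.+1 x y = \sum_(s <- S) mu s * tr n (x * s)%g y.
Proof.
rewrite /transition convolution_powerE iterS /conv_step; apply: eq_bigr => s _.
by rewrite convolution_powerE invgM mulgA.
Qed.

Lemma transition_mulg n g x y : tr n (g * x)%g (g * y)%g = tr n x y.
Proof. by rewrite /transition invgM -mulgA mulKg. Qed.

Lemma transition_ge0 n x y : 0 <= tr n x y.
Proof.
elim: n x => [|n ih] x; first by rewrite transition0.
by rewrite transitionS sumr_ge0// => s _; rewrite mulr_ge0.
Qed.

Lemma transition_mul_le i j x a y : tr i x a * tr j a y <= tr (i + j)%N x y.
Proof.
elim: i x => [|i ih] x.
  rewrite transition0; case: eqP => [->|_]; first by rewrite mul1r.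
  by rewrite mul0r transition_ge0.
rewrite addSn !transitionS mulr_suml; apply: ler_sum => s _.
by rewrite -mulrA ler_wpM2l.
Qed.

Lemma transition_sum_le1 n x (V : {fset G}) : \sum_(g <- V) tr n x g <= 1.
Proof.
elim: n x => [|n ih] x.
  under eq_bigr do rewrite transition0.
  have [xV|xV] := boolP (x \in V).
    rewrite (big_fsetD1 x)//= eqxx big_seq big1 ?addr0// => g.
    by rewrite in_fsetD1 eq_sym => /andP[/negbTE ->].
  rewrite big_seq big1 ?ler01// => g gV.
  by case: eqP gV xV => // -> ->.
under eq_bigr do rewrite transitionS.
rewrite exchange_big/= -mu_sum; apply: ler_sum => s _.
by rewrite -mulr_sumr ler_piMr.
Qed.

(** Truncated Green function: inequalities are proved for it by induction on [N] and then passed to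
    the limit. *)
Definition psum N x y : R := \sum_(0 <= n < N) tr n x y.

Lemma psum_ge0 N x y : 0 <= psum N x y.
Proof. by apply: sumr_ge0 => n _; exact: transition_ge0. Qed.

Lemma psumS N x y : psum N.+1 x y =
  (x == y)%:R + \sum_(s <- S) mu s * psum N (x * s)%g y.
Proof.
rewrite /psum big_nat_recl// transition0; congr (_ + _).
under eq_bigr do rewrite transitionS.
rewrite exchange_big/=; apply: eq_bigr => s _; by rewrite mulr_sumr.
Qed.

Lemma psum_nondecreasing N M x y : (N <= M)%N -> psum N x y <= psum M x y.
Proof.
move=> NM; rewrite /psum (big_cat_nat _ NM)//= lerDl.
by apply: sumr_ge0 => n _; exact: transition_ge0.
Qed.

Lemma psum_mulg N g x y : psum N (g * x)%g (g * y)%g = psum N x y.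
Proof. by apply: eq_bigr => n _; exact: transition_mulg. Qed.

(** * Finiteness of the Green function and its multiplicative inequalities *)

Section Green.
Variables (A t : R).
Hypothesis A0 : 0 < A.
Hypothesis t0 : 0 < t.
Hypothesis t1 : t < 1.
Hypothesis decay : forall n x y, tr n x y <= A * t ^+ n.

Lemma tail_le k N x y :
  \sum_(0 <= n < N | (k <= n)%N) tr n x y <= A / (1 - t) * t ^+ k.
Proof.
have t1' : 0 < 1 - t by rewrite subr_gt0.
apply: (@le_trans _ _ (A * \sum_(0 <= n < N | (k <= n)%N) t ^+ n)).
  by rewrite mulr_sumr; apply: ler_sum => n _; exact: decay.
rewrite -mulrA ler_pM2l// ler_pdivlMl//.
(* The maximum covers the case N <= k, where the sum is empty. *)
suff -> : (1 - t) * \sum_(0 <= n < N | (k <= n)%N) t ^+ n = t ^+ k - t ^+ maxn k N.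
  by rewrite lerBlDr lerDl exprn_ge0// ltW.
elim: N => [|N ih]; first by rewrite big_geq// mulr0 maxn0 subrr.
rewrite big_mkcond big_nat_recr//= -big_mkcond mulrDr ih.
case: leqP => kN.
  by rewrite (maxn_idPr (leqW kN)) exprS; ring.
by rewrite mulr0 addr0 (maxn_idPl kN).
Qed.

(** [fine] sends infinite values to 0; [greenE] shows that no value is infinite. *)
Definition gr x y : R := fine (green mu x y).

Let psum_is_cvg x y : cvgn (fun N => psum N x y).
Proof.
apply: nondecreasing_is_cvgn; first by move=> N M NM; exact: psum_nondecreasing.
exists (A / (1 - t)) => _ [N _ <-]; apply: le_trans (tail_le 0 N x y) _.
by rewrite expr0 mulr1.
Qed.

Let green_limn x y : green mu x y = (limn (fun N => psum N x y))%:E.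
Proof.
rewrite -EFin_lim; last exact: psum_is_cvg.
by congr (limn _); apply/funext => N; rewrite /= -sumEFin.
Qed.

Lemma greenE x y : green mu x y = (gr x y)%:E.
Proof. by rewrite /gr green_limn. Qed.

Lemma psum_cvg x y : (fun N => psum N x y) @ \oo --> gr x y.
Proof. by rewrite /gr green_limn; exact: psum_is_cvg. Qed.

Lemma psum_le_gr N x y : psum N x y <= gr x y.
Proof.
apply: (cvgr_to_ge (@psum_cvg x y)); exists N => // M /= NM.
exact: psum_nondecreasing.
Qed.

Lemma gr_ge0 x y : 0 <= gr x y.
Proof. exact: le_trans (psum_ge0 0 x y) (psum_le_gr 0 x y). Qed.

(** The factor [b] allows two successive passages to the limit, one in each factor of a product. *)
Lemma gr_mul_le x y b c : (forall N, psum N x y * b <= c) -> gr x y * b <= c.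
Proof.
move=> h.
have hb : (fun N => psum N x y * b) @ \oo --> gr x y * b.
  by apply: cvgMl; exact: psum_cvg.
by apply: (cvgr_to_le hb); apply: nearW => N; exact: h.
Qed.

Lemma gr_le x y c : (forall N, psum N x y <= c) -> gr x y <= c.
Proof. by move=> h; rewrite -[gr x y]mulr1; apply: gr_mul_le => N; rewrite mulr1. Qed.

Lemma gr_mulg g x y : gr (g * x)%g (g * y)%g = gr x y.
Proof.
apply/eqP; rewrite eq_le; apply/andP; split; apply: gr_le => N.
  by rewrite psum_mulg psum_le_gr.
by rewrite -(psum_mulg N g) psum_le_gr.
Qed.

Lemma gr_diag x : gr x x = gr 1%g 1%g.
Proof. by rewrite -[in LHS](mulg1 x) gr_mulg. Qed.

Lemma gr_diag_ge1 : 1 <= gr 1%g 1%g.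
Proof.
by apply: le_trans (psum_le_gr 1 _ _); rewrite /psum big_nat1 transition0 eqxx.
Qed.

(* Away from a both sides obey the one-step recursion in x, so that an estimate is
   needed only at x = a. *)
Lemma psum_mul_le N M x a y :
  psum N x a * psum M a y <= gr 1%g 1%g * psum (N + M) x y.
Proof.
have g0 := gr_ge0 1%g 1%g.
elim: N x => [|N ih] x.
  by rewrite /psum big_geq// mul0r mulr_ge0// psum_ge0.
have [<-|/eqP xa] := eqVneq x a.
  apply: ler_pM; rewrite ?psum_ge0//; first by rewrite -(gr_diag x) psum_le_gr.
  exact/psum_nondecreasing/leq_addl.
rewrite psumS (negbTE (introN eqP xa)) add0r addSn psumS mulrDr.
apply: ler_wpDl; first by rewrite mulr_ge0.
rewrite mulr_suml mulr_sumr; apply: ler_sum => s _.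
by rewrite -mulrA (mulrCA (gr _ _)) ler_wpM2l.
Qed.

Lemma gr_mul_le_gr x a y : gr x a * gr a y <= gr 1%g 1%g * gr x y.
Proof.
apply: gr_mul_le => N; rewrite mulrC; apply: gr_mul_le => M; rewrite mulrC.
apply: le_trans (psum_mul_le _ _ _ _ _) _.
by rewrite ler_wpM2l ?gr_ge0 ?psum_le_gr.
Qed.

(** Harnack inequality in the endpoint: appending a path of length [k] shifts the time n < N to n +
    k < k + N. The next lemma is its counterpart for the starting point. *)
Lemma gr_shift_le k x a y : gr x a * tr k a y <= gr x y.
Proof.
apply: gr_mul_le => N; apply: le_trans (psum_le_gr (k + N) x y).
rewrite /psum mulr_suml (@big_cat_nat _ _ _ k 0 (k + N))//= ?leq_addr//.
apply: ler_wpDl; first by apply: sumr_ge0 => n _; exact: transition_ge0.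
have -> : \sum_(k <= n < k + N) tr n x y = \sum_(0 <= n < N) tr (n + k)%N x y.
  by rewrite -{1}[k]add0n big_addn addKn.
by apply: ler_sum => n _; exact: transition_mul_le.
Qed.

Lemma gr_shift_ge k x a y : tr k x a * gr a y <= gr x y.
Proof.
rewrite mulrC; apply: gr_mul_le => N; apply: le_trans (psum_le_gr (k + N) x y).
rewrite /psum mulr_suml (@big_cat_nat _ _ _ k 0 (k + N))//= ?leq_addr//.
apply: ler_wpDl; first by apply: sumr_ge0 => n _; exact: transition_ge0.
have -> : \sum_(k <= n < k + N) tr n x y = \sum_(0 <= n < N) tr (n + k)%N x y.
  by rewrite -{1}[k]add0n big_addn addKn.
by apply: ler_sum => n _; rewrite mulrC addnC; exact: transition_mul_le.
Qed.

End Green.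
End Walk.

(** * Trajectories *)

Lemma ler_sum_mem (R : numDomainType) (I : eqType) (r : seq I) (P : pred I)
    (F : I -> R) i :
  i \in r -> P i -> (forall j, 0 <= F j) -> F i <= \sum_(j <- r | P j) F j.
Proof.
move=> ir Pi F0; rewrite (big_rem i)//= Pi lerDl.
by apply: sumr_ge0.
Qed.

(** The pairs (i, j) with i + j < N form part of the square [0, N) x [0, N), and the terms are
    nonnegative. *)
Lemma cauchy_product_le (R : numDomainType) (u v : nat -> R) N :
  (forall i, 0 <= u i) -> (forall i, 0 <= v i) ->
  \sum_(0 <= n < N) \sum_(0 <= i < n.+1) u i * v (n - i)%N <=
  (\sum_(0 <= i < N) u i) * (\sum_(0 <= j < N) v j).
Proof.
move=> u0 v0.
have -> : \sum_(0 <= n < N) \sum_(0 <= i < n.+1) u i * v (n - i)%N =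
    \sum_(0 <= n < N) \sum_(0 <= i < N | (i <= n)%N) u i * v (n - i)%N.
  apply: eq_big_nat => n /andP[_ nN].
  by rewrite (big_nat_widen _ _ _ _ _ nN); apply: eq_bigl => i.
rewrite (exchange_big_dep predT)//= mulr_suml; apply: ler_sum => i _.
rewrite -mulr_sumr ler_wpM2l//.
have [iN|Ni] := leqP i N; last first.
  by rewrite [leLHS]big_nat_cond [leLHS]big_pred0 ?sumr_ge0// => j; lia.
have -> : \sum_(0 <= n < N | (i <= n)%N) v (n - i)%N = \sum_(i <= n < N) v (n - i)%N.
  by rewrite [RHS](big_nat_widenl _ 0)//; apply: eq_bigl => j; rewrite andbT.
rewrite -{1}[i]add0n big_addn (big_cat_nat _ (leq_subr i N))//=.
under eq_bigr do rewrite addnK.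
by rewrite lerDl sumr_ge0.
Qed.

Section Trajectories.
Variables (R : realType) (G : groupType) (mu : G -> R) (S : {fset G}).
Hypothesis mu_ge0 : forall g, 0 <= mu g.
Hypothesis mu_supp : forall g, g \notin S -> mu g = 0.
Hypothesis mu_sum : \sum_(s <- S) mu s = 1.

Local Notation tr := (transition mu).
Local Notation pos w i := (nth 1%g w i).

Definition trajectory n x (w : seq G) :=
  [/\ size w = n.+1, pos w 0 = x &
      forall i, (i < n)%N -> ((pos w i)^-1 * pos w i.+1)%g \in S].

(** Expectation of [Phi] over the list of the n + 1 positions of the walk from [x], computed by
    conditioning on the first step; no measure on the space of trajectories is needed. *)
Fixpoint pathE n x (Phi : seq G -> R) : R :=
  if n is n'.+1 then \sum_(s <- S) mu s * pathE n' (x * s)%g (fun w => Phi (x :: w))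
  else Phi [:: x].

Lemma pathE_le n x Phi Psi :
  (forall w, trajectory n x w -> Phi w <= Psi w) -> pathE n x Phi <= pathE n x Psi.
Proof.
elim: n x Phi Psi => [|n ih] x Phi Psi h /=; first exact: h.
rewrite big_seq [leRHS]big_seq; apply: ler_sum => s sS; rewrite ler_wpM2l//.
apply: ih => w [sw w0 wS]; apply: h; split => //=; first by rewrite sw.
by move=> [_|i] /=; [rewrite w0 mulKg|exact: wS].
Qed.

Lemma eq_pathE n x Phi Psi :
  (forall w, trajectory n x w -> Phi w = Psi w) -> pathE n x Phi = pathE n x Psi.
Proof.
by move=> h; apply/eqP; rewrite eq_le; apply/andP; split; apply: pathE_le => w /h ->.
Qed.

Lemma pathED n x Phi Psi :
  pathE n x (fun w => Phi w + Psi w) = pathE n x Phi + pathE n x Psi.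
Proof.
elim: n x Phi Psi => [//|n ih] x Phi Psi /=.
by rewrite -big_split; apply: eq_bigr => s _; rewrite ih mulrDr.
Qed.

Lemma pathEZ n x c Phi : pathE n x (fun w => c * Phi w) = c * pathE n x Phi.
Proof.
elim: n x Phi => [//|n ih] x Phi /=.
by rewrite mulr_sumr; apply: eq_bigr => s _; rewrite ih mulrCA.
Qed.

Lemma pathE_sum (I : Type) (r : seq I) (P : pred I) (F : I -> seq G -> R) n x :
  pathE n x (fun w => \sum_(i <- r | P i) F i w) = \sum_(i <- r | P i) pathE n x (F i).
Proof.
elim: r => [|i r ih].
  (* The empty sum is written as 0 * 0 so that [pathEZ] applies. *)
  under eq_pathE do rewrite big_nil -(mul0r 0).
  by rewrite pathEZ mul0r big_nil.
rewrite big_cons -ih; case: ifP => Pi.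
  by rewrite -pathED; apply: eq_pathE => w _; rewrite big_cons Pi.
by apply: eq_pathE => w _; rewrite big_cons Pi.
Qed.

Lemma pathE_end n x y : pathE n x (fun w => (pos w n == y)%:R) = tr n x y.
Proof.
elim: n x => [|n ih] x; first by rewrite transition0.
by rewrite (transitionS mu_supp) /=; apply: eq_bigr => s _; rewrite ih.
Qed.

Lemma markov_property n i x a Psi : (i <= n)%N ->
  pathE n x (fun w => (pos w i == a)%:R * Psi (drop i w)) =
    tr i x a * pathE (n - i) a Psi.
Proof.
elim: i n x => [|i ih] n x.
  move=> _; rewrite transition0 subn0.
  rewrite (@eq_pathE _ _ _ (fun w => (x == a)%:R * Psi w)) => [|w [_ -> _]].
    by rewrite pathEZ; case: eqP => [->//|_]; rewrite !mul0r.
  by rewrite drop0.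
case: n => // n; rewrite ltnS => leq_in /=.
rewrite (transitionS mu_supp) mulr_suml; apply: eq_bigr => s _.
by rewrite ih// mulrA.
Qed.

(** The indicator that a trajectory ends at [y] is at most the sum of the indicators of all visits
    to [B] and of all pairs of positions in [V] that are at least [k] apart in time. Taking
    expectations, the Markov property factorizes each term. *)
Lemma transition_union_bound n x y (B V : {fset G}) (k : G -> G -> nat) :
  (forall w, trajectory n x w -> pos w n = y ->
     (exists2 i, (i <= n)%N & pos w i \in B) \/
     (exists i j, [/\ (i <= j <= n)%N, pos w i \in V, pos w j \in V &
         (k (pos w i) (pos w j) <= j - i)%N])) ->
  tr n x y <= \sum_(h <- B) \sum_(0 <= i < n.+1) tr i x h * tr (n - i) h y +
     \sum_(a <- V) \sum_(b <- V) \sum_(0 <= i < n.+1) tr i x a *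
        \sum_(0 <= m < (n - i).+1) (k a b <= m)%:R * tr m a b * tr (n - i - m) b y.
Proof.
move=> hw.
(* [F] marks a visit to h at time i, and [H] a visit to a at time i followed by one to b after m
   steps. The nested [drop] puts them in the form required by [markov_property]. *)
pose F h i w : R := (pos w i == h)%:R * (pos (drop i w) (n - i) == y)%:R.
pose Q b m l v : R := (pos v m == b)%:R * (pos (drop m v) l == y)%:R.
pose H a b i w : R := (pos w i == a)%:R *
   \sum_(0 <= m < (n - i).+1) (k a b <= m)%:R * Q b m (n - i - m)%N (drop i w).
have F0 h i w : 0 <= F h i w by rewrite mulr_ge0.
have Q0 b m l w : 0 <= Q b m l w by rewrite mulr_ge0.
have H0 a b i w : 0 <= H a b i w.
  by rewrite mulr_ge0// sumr_ge0// => m _; rewrite mulr_ge0.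
rewrite -[leLHS]pathE_end.
apply: (@le_trans _ _ (pathE n x (fun w =>
    \sum_(h <- B) \sum_(0 <= i < n.+1) F h i w +
    \sum_(a <- V) \sum_(b <- V) \sum_(0 <= i < n.+1) H a b i w))).
  apply: pathE_le => w tw; case: eqP => [wy|_]; last first.
    by apply: addr_ge0; do !(apply: sumr_ge0 => ? _).
  case: (hw w tw wy) => [[i iN iB]|[i [j [/andP[ij jn] iV jV kij]]]].
    apply: ler_wpDr; first by do !(apply: sumr_ge0 => ? _).
    apply: (@le_trans _ _ (\sum_(0 <= i' < n.+1) F (pos w i) i' w)); last first.
      by apply: (ler_sum_mem (F := fun h => \sum_(0 <= i < n.+1) F h i w)) => // h;
        exact: sumr_ge0.
    apply: (@le_trans _ _ (F (pos w i) i w)).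
      by rewrite /F eqxx mul1r nth_drop subnKC// wy eqxx.
    by apply: (ler_sum_mem (F := fun i' => F (pos w i) i' w)) => //;
      rewrite mem_index_iota; lia.
  apply: ler_wpDl; first by do !(apply: sumr_ge0 => ? _).
  set a := pos w i; set b := pos w j.
  apply: (@le_trans _ _ (\sum_(b <- V) \sum_(0 <= i' < n.+1) H a b i' w)); last first.
    by apply: (ler_sum_mem (F := fun a =>
      \sum_(b <- V) \sum_(0 <= i < n.+1) H a b i w)) => // h;
      do !(apply: sumr_ge0 => ? _).
  apply: (@le_trans _ _ (\sum_(0 <= i' < n.+1) H a b i' w)); last first.
    by apply: (ler_sum_mem (F := fun b => \sum_(0 <= i < n.+1) H a b i w)) => // h;
      do !(apply: sumr_ge0 => ? _).
  apply: (@le_trans _ _ (H a b i w)); last first.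
    by apply: (ler_sum_mem (F := fun i' => H a b i' w)) => //;
      rewrite mem_index_iota; lia.
  rewrite /H eqxx mul1r.
  apply: (@le_trans _ _
    ((k a b <= j - i)%:R * Q b (j - i)%N (n - i - (j - i))%N (drop i w))).
    rewrite kij mul1r /Q drop_drop !nth_drop.
    have -> : (i + (j - i) = j)%N by lia.
    have -> : (j - i + i + (n - i - (j - i)) = n)%N by lia.
    by rewrite wy !eqxx mul1r.
  apply: (ler_sum_mem (F := fun m =>
    (k a b <= m)%:R * Q b m (n - i - m)%N (drop i w))) => //.
    by rewrite mem_index_iota; lia.
  by move=> m; rewrite mulr_ge0.
rewrite pathED; apply: lerD.
  rewrite pathE_sum; apply: ler_sum => h _; rewrite pathE_sum.
  rewrite big_nat [leRHS]big_nat; apply: ler_sum => i /andP[_ iN].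
  by rewrite (markov_property x h (fun v => (pos v (n - i) == y)%:R)) // pathE_end.
rewrite pathE_sum; apply: ler_sum => a _; rewrite pathE_sum; apply: ler_sum => b _.
rewrite pathE_sum big_nat [leRHS]big_nat; apply: ler_sum => i /andP[_ iN].
rewrite (markov_property x a (fun v =>
  \sum_(0 <= m < (n - i).+1) (k a b <= m)%:R * Q b m (n - i - m)%N v)) //.
rewrite ler_wpM2l ?(transition_ge0 mu_ge0 mu_supp)// pathE_sum.
rewrite big_nat [leRHS]big_nat; apply: ler_sum => m /andP[_ mN].
rewrite pathEZ (markov_property a b (fun v => (pos v (n - i - m) == y)%:R)) //.
by rewrite pathE_end mulrA.
Qed.

End Trajectories.

(** * Orbit length *)

Lemma compact_mdist_bounded (R : realType) (X : metricType R) (o : X) (K : set X) :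
  compact K -> exists D : nat, forall p, K p -> mdist o p <= D%:R.
Proof.
move=> /compact_near_coveringP/(_ nat \oo (fun n p => mdist o p <= n%:R)).
case=> [p Kp|D _ /(_ D (leqnn D)) KD]; last by exists D => p /KD.
exists (ball p 1, [set n | mdist o p + 1 <= n%:R]) => /=.
  split; first exact: nbhsx_ballx.
  exists (Num.truncn (mdist o p + 1)).+1 => // n /= hn.
  apply: le_trans (ltW (real_truncnS_gt _)) _; last by rewrite ler_nat.
  by rewrite ger0_real// addr_ge0// mdist_ge0.
move=> [q n] /=; rewrite ballEmdist /= => -[pq pn].
by apply: le_trans (metric_triangle o p q) (le_trans _ pn); rewrite lerD2l ltW.
Qed.

Section OrbitLength.
Variables (R : realType) (G : groupType) (X : metricType R).
Variables (act : G -> X -> X) (o : X).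
Hypothesis act_geometric : geometric_action act.
Hypothesis X_proper : proper_space X.
Hypothesis X_geodesic : geodesic_space X.

(** Floor plus one gives distance < [len] <= distance + 1, which keeps subadditivity among integers;
    in particular the identity has length 1, not 0. *)
Definition len (g : G) : nat := (Num.truncn (mdist o (act g o))).+1.

Lemma act1 p : act 1%g p = p.
Proof. by case: act_geometric => -[]. Qed.

Lemma actM g h p : act (g * h)%g p = act g (act h p).
Proof. by case: act_geometric => -[]. Qed.

Lemma act_isom g p q : mdist (act g p) (act g q) = mdist p q.
Proof. by case: act_geometric. Qed.

Lemma mdist_act g h : mdist (act g o) (act h o) = mdist o (act (g^-1 * h)%g o).
Proof. by rewrite -(act_isom g^-1%g) -!actM mulVg act1. Qed.

Lemma mdist_lt_len g h : mdist (act g o) (act h o) < (len (g^-1 * h)%g)%:R.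
Proof. by rewrite mdist_act real_truncnS_gt// ger0_real// mdist_ge0. Qed.

Lemma len_le_mdist g h : (len (g^-1 * h)%g)%:R <= mdist (act g o) (act h o) + 1.
Proof. by rewrite mdist_act -natr1 lerD2r truncn_le mdist_ge0. Qed.

Lemma len_le g n : mdist o (act g o) < n%:R -> (len g <= n)%N.
Proof. by move=> gn; rewrite truncn_lt_nat// mdist_ge0. Qed.

Lemma len1 : len 1%g = 1%N.
Proof. by rewrite /len act1 mdistxx truncn0. Qed.

Lemma lenV g : len g^-1%g = len g.
Proof. by rewrite /len -[mdist _ _](act_isom g) -actM mulgV act1 metric_sym. Qed.

Lemma lenM g h : (len (g * h)%g <= len g + len h)%N.
Proof.
apply: len_le; rewrite natrD.
have hl k : mdist o (act k o) < (len k)%:R.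
  by have := mdist_lt_len 1%g k; rewrite act1 invg1 mul1g.
apply: le_lt_trans (metric_triangle _ (act g o) _) _.
by rewrite actM act_isom ltrD.
Qed.

Lemma len_triangle x y z : (len (x^-1 * z)%g <= len (x^-1 * y)%g + len (y^-1 * z)%g)%N.
Proof. by have := lenM (x^-1 * y)%g (y^-1 * z)%g; rewrite -mulgA mulVKg. Qed.

Lemma len_sym x y : len (x^-1 * y)%g = len (y^-1 * x)%g.
Proof. by rewrite -[LHS]lenV invgM invgK. Qed.

Lemma finite_len_le n : finite_set [set g | (len g <= n)%N].
Proof.
case: act_geometric => _ _ act_proper _.
apply: sub_finite_set (act_proper _ (@X_proper o n%:R)) => g /= gn.
have h : mdist o (act g o) <= n%:R.
  apply: (@le_trans _ _ (len g)%:R); last by rewrite ler_nat.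
  by have := ltW (mdist_lt_len 1%g g); rewrite act1 invg1 mul1g.
by exists (act g o); split => //=; exists o => //=; rewrite mdistxx.
Qed.

(** Subdivide a geodesic into steps of length at most 1 and replace each point by an orbit point
    within [D], using cocompactness. Consecutive orbit points are then within 2D + 1, and rounding
    gives 2D + 2. *)
Lemma len_chain : exists L : nat, forall x y, exists f : nat -> G,
  [/\ f 0%N = x, f (len (x^-1 * y)%g) = y &
      forall i, (len ((f i)^-1 * f i.+1)%g <= L)%N].
Proof.
case: act_geometric => _ _ _ [K /compact_mdist_bounded-/(_ o) [D KD] Kcov].
have dense p : exists g, mdist p (act g o) <= D%:R.
  have : [set: X] p by []; rewrite -Kcov => -[g _ [q Kq <-]].
  by exists g; rewrite act_isom metric_sym KD.
exists (2 * D + 2)%N => x y.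
have [phi [phi0 phi1 phid]] := X_geodesic (act x o) (act y o).
set d := mdist (act x o) (act y o) in phi1 phid.
have d0 : 0 <= d := mdist_ge0 _ _.
set n := len _; have n0 : 0 < n%:R :> R by rewrite ltr0n.
have dn : d <= n%:R by apply/ltW/mdist_lt_len.
(* The minimum keeps the sample at the far endpoint for all later indices, since [f] is defined on
   all integers. *)
pose u (i : nat) : R := (minn i n)%:R / n%:R * d.
have u01 i : 0 <= u i <= d.
  rewrite /u mulr_ge0 ?divr_ge0//= ler_piMl// ler_pdivrMr// mul1r ler_nat.
  exact: geq_minr.
have /choice[f0 Hf0] (i : nat) : exists g, mdist (phi (u i)) (act g o) <= D%:R :=
  dense _.
pose f i := if i == 0%N then x else if (n <= i)%N then y else f0 i.
have Hf i : mdist (phi (u i)) (act (f i) o) <= D%:R.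
  rewrite /f; case: eqP => [->|_].
    by rewrite /u min0n mul0r mul0r phi0 mdistxx.
  case: ifP => [ni|_]; last exact: Hf0.
  by rewrite /u (minn_idPr ni) divff ?gt_eqF// mul1r phi1 mdistxx.
exists f; split => [//||i].
  by rewrite /f leqnn; case: eqP n0 => // ->; rewrite ltxx.
apply: len_le; rewrite -mdist_act.
have h1 : mdist (phi (u i)) (phi (u i.+1)) <= 1.
  rewrite phid ?in_itv//= ?u01// distrC /u -!mulrBl.
  rewrite normrM (ger0_norm d0) normrM normfV (gtr0_norm n0) mulrAC ler_pdivrMr// mul1r.
  apply: le_trans dn; rewrite ler_piMl//.
  rewrite -natrB; last lia.
  rewrite ger0_norm// (_ : 1 = 1%:R)// ler_nat; lia.
have := metric_triangle (act (f i) o) (phi (u i)) (act (f i.+1) o).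
have := metric_triangle (phi (u i)) (phi (u i.+1)) (act (f i.+1) o).
have := Hf i.+1; have := Hf i;
  rewrite [mdist _ (act (f i) o)]metric_sym natrD natrM; lra.
Qed.

End OrbitLength.

(** * Chains of minimal cost *)

Section MinimalChain.
Variables (T : choiceType) (d : T -> T -> nat) (L : nat).
Hypothesis d_triangle : forall p q r, (d p r <= d p q + d q r)%N.
Hypothesis d_refl : forall p, (d p p <= 1)%N.
Hypothesis d_chain : forall p q, exists f : nat -> T,
  [/\ f 0%N = p, f (d p q) = q & forall i, (d (f i) (f i.+1) <= L)%N].
Variables (c : T -> T -> nat) (M : nat).
Hypothesis c_le : forall p q, (c p q <= M)%N.

Inductive reach (x : T) : T -> nat -> Prop :=
| Reach0 : reach x x 0
| ReachS p q k : reach x p k -> (d p q <= L)%N -> reach x q (k + c p q).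

(** The inequality a < b is strict because [d p p] may be 1; [chain_dist_refl] pays one unit for
    equality. *)
Lemma chain_dist (P : nat -> T) n a b :
  (forall i, (i < n)%N -> (d (P i) (P i.+1) <= L)%N) ->
  (a < b <= n)%N -> (d (P a) (P b) <= L * (b - a))%N.
Proof.
move=> PL; elim: b => [//|b ih] /andP[]; rewrite ltnS leq_eqVlt => /orP[/eqP <-|ab] bn.
  by rewrite subSnn muln1 PL.
have := d_triangle (P a) (P b) (P b.+1).
have := PL b bn; have := ih; rewrite ab (ltnW bn) => /(_ isT).
by rewrite (subSn (ltnW ab)) mulnS; lia.
Qed.

Lemma chain_dist_refl (P : nat -> T) n a b :
  (forall i, (i < n)%N -> (d (P i) (P i.+1) <= L)%N) ->
  (a <= b <= n)%N -> (d (P a) (P b) <= L * (b - a) + 1)%N.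
Proof.
move=> PL /andP[]; rewrite leq_eqVlt => /orP[/eqP <- _|ab bn].
  by rewrite subnn muln0.
by apply: leq_trans (chain_dist PL _) _; rewrite ?ab ?bn// leq_addr.
Qed.

Lemma exists_reach x y : exists k, reach x y k.
Proof.
have [f [f0 fn fL]] := d_chain x y; rewrite -fn; elim: (d x y) => [|n [k hk]].
  by exists 0%N; rewrite f0; exact: Reach0.
by exists (k + c (f n) (f n.+1))%N; exact: ReachS.
Qed.

Lemma exists_potential x : exists D : T -> nat,
  (forall y, reach x y (D y)) /\ (forall y k, reach x y k -> (D y <= k)%N).
Proof.
have h y : exists k, reach x y k /\ (forall k', reach x y k' -> (k <= k')%N).
  have [k hk] := exists_reach x y.
  have ex : exists k, `[< reach x y k >] by exists k; apply/asboolP.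
  exists (ex_minn ex); case: ex_minnP => m /asboolP hm mmin; split => // k' hk'.
  by apply: mmin; apply/asboolP.
have [D hD] := choice h.
by exists D; split => y; [case: (hD y)|move=> k; case: (hD y) => _; exact].
Qed.

(** [D] is the minimal cost from [x]. Along an optimal chain every initial segment is optimal too,
    so [D] grows exactly by the cost of each step. *)
Lemma exists_tight_chain x y : exists (D : T -> nat) (n : nat) (P : nat -> T),
  [/\ forall p q, (d p q <= L)%N -> (D q <= D p + c p q)%N,
      P 0%N = x, P n = y,
      forall i, (i < n)%N -> (d (P i) (P i.+1) <= L)%N &
      forall i, (i < n)%N -> D (P i.+1) = (D (P i) + c (P i) (P i.+1))%N].
Proof.
have [D [Dr Dmin]] := exists_potential x.
have Dstep p q : (d p q <= L)%N -> (D q <= D p + c p q)%N.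
  by move=> pq; apply: Dmin; exact: ReachS.
exists D; have : reach x y (D y) by [].
move: {-2}(D y) (erefl (D y)) => k + hk; elim: hk => {y k} [|p q k hk ih pq] Dk.
  by exists 0%N, (fun=> x).
(* The prefix cost [k] is at least [D p] by minimality, and at most [D p] because the whole chain is
   optimal. *)
have Dp : D p = k.
  have := Dstep _ _ pq; have := Dmin _ _ hk; lia.
have [n [P [_ P0 Pn PL PD]]] := ih (esym Dp).
exists n.+1, (fun i => if (i <= n)%N then P i else q); split => //.
- by rewrite ltnn.
- move=> i; rewrite ltnS => iN; rewrite iN; case: ltnP => [/PL//|ni].
  by have -> : i = n by [lia]; rewrite Pn.
- move=> i; rewrite ltnS => iN; rewrite iN; case: ltnP => [/PD//|ni].
  by have -> : i = n by [lia]; rewrite Pn Dp.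
Qed.

Lemma potential_chain_le (D : T -> nat) :
  (forall p q, (d p q <= L)%N -> (D q <= D p + c p q)%N) ->
  forall p q, (D q <= D p + M * d p q)%N.
Proof.
move=> Dstep p q; have [f [f0 fn fL]] := d_chain p q.
rewrite -{1}fn -f0; elim: (d (f 0%N) q) => [|n ih]; first by rewrite muln0 addn0.
have := Dstep _ _ (fL n); have := c_le (f n) (f n.+1); rewrite mulnS; lia.
Qed.

End MinimalChain.

Lemma last_index (Q : nat -> Prop) k : Q 0%N ->
  exists2 a, (a <= k)%N /\ Q a & forall i, (a < i <= k)%N -> ~ Q i.
Proof.
move=> Q0; elim: k => [|k [a [ak Qa] ha]]; first by exists 0%N => // i; lia.
have [Qk|nQk] := pselect (Q k.+1); first by exists k.+1 => // i; lia.
exists a; first by split => //; lia.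
move=> i /andP[ai]; rewrite leq_eqVlt => /orP[/eqP ->//|ik]; apply: ha; lia.
Qed.

(** This is [last_index] read backwards from [n]. *)
Lemma first_index (Q : nat -> Prop) k n : (k <= n)%N -> Q n ->
  exists2 b, (k <= b <= n)%N /\ Q b & forall i, (k <= i < b)%N -> ~ Q i.
Proof.
move=> kn Qn.
have Qn0 : Q (n - 0)%N by rewrite subn0.
have [a [ak Qa] ha] := @last_index (fun i => Q (n - i)%N) (n - k) Qn0.
exists (n - a)%N; first by split => //; lia.
move=> i hi Qi; apply: (ha (n - i)%N); first lia.
by rewrite subKn//; lia.
Qed.

(** * Replacing a tame path by a quasi-geodesic chain *)

Section Detour.
Variables (T : choiceType) (d : T -> T -> nat) (L : nat).
Hypothesis d_sym : forall p q, d p q = d q p.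
Hypothesis d_triangle : forall p q r, (d p r <= d p q + d q r)%N.
Hypothesis d_chain : forall p q, exists f : nat -> T,
  [/\ f 0%N = p, f (d p q) = q & forall i, (d (f i) (f i.+1) <= L)%N].
Hypothesis L_gt0 : (0 < L)%N.

(* Minimize the cost of a chain when the steps of w, in either direction, cost 1
   and all others cost 2 K L. An excursion of the minimizer off w which comes
   close to z would cost more than the portion of w between its endpoints. *)
Lemma exists_detour (K N r : nat) (w : nat -> T) (z : T) : (0 < K)%N ->
  (forall i, (i < N)%N -> (d (w i) (w i.+1) <= L)%N) ->
  (forall i j, (i <= j <= N)%N -> (j - i <= K * (d z (w i) + d z (w j)))%N) ->
  (forall i, (i <= N)%N -> (r <= d z (w i))%N) ->
  exists (n : nat) (P : nat -> T),
    [/\ P 0%N = w 0%N, P n = w N,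
        forall i, (i < n)%N -> (d (P i) (P i.+1) <= L)%N,
        forall a b, (a <= b <= n)%N -> (b - a <= 2 * K * L * d (P a) (P b))%N &
        forall k, (k <= n)%N -> (r <= 2 * d z (P k))%N].
Proof.
move=> K_gt0 wL tame wr.
pose E p q := exists2 i, (i < N)%N & (p = w i /\ q = w i.+1) \/ (p = w i.+1 /\ q = w i).
pose c p q := if `[< E p q >] then 1%N else (2 * K * L)%N.
have c_le p q : (c p q <= 2 * K * L)%N by rewrite /c; case: ifP => // _; nia.
have c_gt0 p q : (0 < c p q)%N by rewrite /c; case: ifP => // _; nia.
have [D [n [P [Dstep P0 Pn PL PD]]]] := exists_tight_chain d_chain c (w 0%N) (w N).
have Dchain := potential_chain_le d_chain c_le Dstep.
exists n, P; split => //.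
  (* Every step costs at least 1, so [D] grows at least linearly along [P], while [Dchain] bounds
     its growth by 2KL times the distance. *)
  move=> a b abn; suff : (D (P a) + (b - a) <= D (P b))%N
    by have := Dchain (P a) (P b); lia.
  elim: b abn => [|b ih] abn; first by have -> : a = 0%N by [lia]; lia.
  have [ab|ab] := leqP a b; last by have -> : a = b.+1 by [lia]; lia.
  have := ih ltac:(lia); have bn : (b < n)%N by lia.
  have := c_gt0 (P b) (P b.+1); rewrite (PD _ bn); lia.
(* Along [w] the potential changes by at most 1 per step, in both directions. *)
have Dw i j : (i <= j <= N)%N -> (D (w j) <= D (w i) + (j - i))%N /\
    (D (w i) <= D (w j) + (j - i))%N.
  elim: j => [|j ih] ijN; first by have -> : i = 0%N by [lia]; lia.
  have [ij|ij] := leqP i j; last by have -> : i = j.+1 by [lia]; lia.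
  have jN : (j < N)%N by lia.
  have c1 : c (w j) (w j.+1) = 1%N by rewrite /c asboolT//; exists j => //; left.
  have c2 : c (w j.+1) (w j) = 1%N by rewrite /c asboolT//; exists j => //; right.
  have := Dstep _ _ (wL j jN); rewrite c1.
  have := wL j jN; rewrite d_sym => /Dstep; rewrite c2.
  have := ih ltac:(lia); lia.
pose on k := exists2 i, (i <= N)%N & P k = w i.
move=> k kn.
have [[i iN Pk]|kon] := pselect (on k); first by rewrite Pk; have := wr i iN; lia.
have [a [ak [i iN Pa]] ha] :
  exists2 a, (a <= k)%N /\ on a & forall i, (a < i <= k)%N -> ~ on i.
  by apply: last_index; exists 0%N.
have [b [/andP[kb bn] [j jN Pb]] hb] :
    exists2 b, (k <= b <= n)%N /\ on b & forall i, (k <= i < b)%N -> ~ on i.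
  by apply: first_index => //; exists N.
have {}ak : (a < k)%N.
  by rewrite ltn_neqAle ak andbT; apply/eqP => ak'; apply: kon; rewrite -ak'; exists i.
have {}kb : (k < b)%N.
  by rewrite ltn_neqAle kb andbT; apply/eqP => kb'; apply: kon; rewrite kb'; exists j.
(* Strictly between [a] and [b] the chain is off [w], so none of the steps there has the cheap
   cost. *)
have off l : (a <= l < b)%N -> c (P l) (P l.+1) = (2 * K * L)%N.
  move=> /andP[al lb]; rewrite /c asboolF// => -[m mN Pm].
  have onl : on l by case: Pm => -[Pl _]; [exists m; [lia|]|exists m.+1].
  have onl1 : on l.+1 by case: Pm => -[_ Pl]; [exists m.+1|exists m; [lia|]].
  have [la|la] := eqVneq l a; first by apply: (ha l.+1) => //; lia.
  have [lk|lk] := leqP l k; first by apply: (ha l) => //; lia.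
  by apply: (hb l) => //; lia.
have Dab : D (P b) = (D (P a) + 2 * K * L * (b - a))%N.
  have h l : (a + l <= b)%N -> D (P (a + l)%N) = (D (P a) + 2 * K * L * l)%N.
    elim: l => [|l ih] alb; first by rewrite addn0 muln0 addn0.
    rewrite addnS PD; last lia.
    rewrite off; last lia.
    rewrite ih; last lia.
    by rewrite mulnS; lia.
  by rewrite -h; [congr (D (P _)); lia|lia].
(* The cost of the excursion is at most the time that [w] takes between the same two points, which
   tameness bounds. *)
have key : (2 * K * L * (b - a) <= K * (d z (w i) + d z (w j)))%N.
  have [ij|ji] := leqP i j.
    have [h1 _] := Dw i j ltac:(lia); have := tame i j ltac:(lia).
    rewrite -Pa -Pb in h1 *; lia.
  have [_ h1] := Dw j i ltac:(lia); have := tame j i ltac:(lia).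
  rewrite -Pa -Pb in h1 *; lia.
have key2 : (2 * (L * (b - a)) <= d z (w i) + d z (w j))%N.
  by rewrite -(leq_pmul2l K_gt0); apply: leq_trans key; rewrite mulnCA !mulnA.
(* Let s be the sum of the distances from z to the two ends of the excursion. Then s <= 2 d(z, P k)
   + L(b - a), while [key2] gives 2L(b - a) <= s; hence 2r <= s <= 4 d(z, P k). *)
have h1 := chain_dist d_triangle PL (a := a) (b := k) ltac:(lia).
have h2 := chain_dist d_triangle PL (a := k) (b := b) ltac:(lia).
have h3 := d_triangle z (P k) (P a); rewrite [d (P k) _]d_sym in h3.
have h4 := d_triangle z (P k) (P b).
have h5 : (L * (b - a) = L * (k - a) + L * (b - k))%N by rewrite -mulnDr;
  congr (_ * _)%N; lia.
have := wr i iN; have := wr j jN; rewrite -Pa -Pb in key2 *; lia.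
Qed.

End Detour.

(** * Morse subsets and chains *)

Section MorseCrossing.
Variables (R : realType) (G : groupType) (X : metricType R).
Variables (act : G -> X -> X) (o : X).
Hypothesis act_geometric : geometric_action act.
Hypothesis X_proper : proper_space X.
Hypothesis X_geodesic : geodesic_space X.

Local Notation len := (len act o).
Local Notation dl p q := (len (p^-1 * q)%g).

(** Quasi-geodesics need not be continuous, so the step function of the chain will do. [L] controls
    the upper bound, [M] the lower one, and the additional 2 absorbs the rounding of times and
    lengths. *)
Lemma chain_quasi_geodesic (L M n : nat) (P : nat -> G) :
  (forall i, (i < n)%N -> (dl (P i) (P i.+1) <= L)%N) ->
  (forall a b, (a <= b <= n)%N -> (b - a <= M * dl (P a) (P b))%N) ->
  quasi_geodesic ((L + M).+2%:R : R) `[0, n%:R]%classic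
    (fun s => act (P (Num.truncn s)) o).
Proof.
move=> PL PM; split; first exact: interval_is_interval.
set c : R := (L + M).+2%:R; have c1 : 1 <= c by rewrite ler1n.
have cE : c = L%:R + M%:R + 2 by rewrite /c -addn2 !natrD.
have L0 : 0 <= L%:R :> R by []. have M0 : 0 <= M%:R :> R by [].
have c0 : 0 < c by lra.
suff H s t : `[0, n%:R]%classic s -> `[0, n%:R]%classic t -> s <= t ->
    c^-1 * (t - s) - c <= mdist (act (P (Num.truncn s)) o) (act (P (Num.truncn t)) o)
      <= c * (t - s) + c.
  move=> s t Is It; have [st|ts] := leP s t.
    by rewrite distrC ger0_norm ?subr_ge0//; exact: H.
  by rewrite ger0_norm ?subr_ge0 ?(ltW ts)// metric_sym; apply: H => //; exact: ltW.
rewrite /= !in_itv/= => /andP[s0 sn] /andP[t0 tn] st.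
set a := Num.truncn s; set b := Num.truncn t.
have ab : (a <= b)%N by exact: le_truncn.
have bn : (b <= n)%N by have := le_truncn tn; rewrite natrK.
have /andP[a1 a2] := truncn_itv s0; have /andP[b1 b2] := truncn_itv t0.
rewrite -/a -/b -!natr1 in a1 a2 b1 b2.
have abn : (a <= b <= n)%N by rewrite ab.
have h1 : (dl (P a) (P b) <= L * (b - a) + 1)%N.
  apply: (chain_dist_refl (d := fun p q => dl p q) _ _ PL abn) => [p q r|p].
    exact: len_triangle.
  by rewrite mulVg len1.
have h2 := PM a b abn.
have d1 := mdist_lt_len o act_geometric (P a) (P b).
have d2 := len_le_mdist o act_geometric (P a) (P b).
move: d1 d2; set l := dl (P a) (P b) in h1 h2 *; set d := mdist _ _ => d1 d2.
rewrite -(ler_nat R) natrD natrM natrB// in h1.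
rewrite -(ler_nat R) natrM natrB// in h2.
have d0 : 0 <= d := mdist_ge0 _ _.
apply/andP; split.
  rewrite lerBlDr ler_pdivrMl//.
  have : M%:R * l%:R <= M%:R * (d + 1) by rewrite ler_wpM2l.
  have : 0 <= (c - M%:R) * d by rewrite mulr_ge0//; lra.
  have : c <= c * c by rewrite ler_peMl// ltW.
  nra.
have : L%:R * (b%:R - a%:R) <= L%:R * (t - s + 1) by rewrite ler_wpM2l//; lra.
have : 0 <= (c - L%:R) * (t - s) by rewrite mulr_ge0//; lra.
nra.
Qed.

(** The neighborhood is defined by an infimum that may not be attained; the added 1 yields an actual
    point of [Y]. *)
Lemma morse_near (kappa : R -> R) (Y : set X) (L M n : nat) (P : nat -> G) :
  morse_set kappa Y ->
  (forall i, (i < n)%N -> (dl (P i) (P i.+1) <= L)%N) ->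
  (forall a b, (a <= b <= n)%N -> (b - a <= M * dl (P a) (P b))%N) ->
  Y (act (P 0%N) o) -> Y (act (P n) o) ->
  forall k, (k <= n)%N ->
    exists2 q, Y q & mdist (act (P k) o) q < kappa (L + M).+2%:R + 1.
Proof.
move=> Ym PL PM Y0 Yn k kn.
have c1 : 1 <= (L + M).+2%:R :> R by rewrite ler1n.
have n0 : 0 <= n%:R :> R by [].
have YP := Ym _ c1 _ _ _ n0 (chain_quasi_geodesic PL PM).
rewrite truncn0 natrK in YP.
have : neighborhood Y (kappa (L + M).+2%:R) (act (P k) o).
  by apply: (YP Y0 Yn); exists k%:R; rewrite /= ?natrK// in_itv/= ler0n ler_nat.
rewrite /neighborhood /= => Yk.
have : (ereal_inf [set (mdist (act (P k) o) q)%:E | q in Y] <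
    (kappa (L + M).+2%:R + 1)%:E)%E.
  by apply: le_lt_trans Yk _; rewrite lte_fin ltrDl.
move=> /ereal_inf_lt[_ [q Yq <-]].
by rewrite lte_fin => kq; exists q.
Qed.

(** Take the last vertex of the chain close to some gamma(v) with v <= t. Its successor is close to
    some gamma(v') with v' >= t, so v and v' are close, t lies between them, and the vertex is near
    z. If that vertex is the end of the chain, v' = u serves. *)
Lemma morse_chain_meets_ball (kappa : R -> R) (c : R) (L M : nat) :
  (forall t : R, 1 <= t -> 0 <= kappa t) -> 1 <= c ->
  exists r : nat, forall (I : set R) (gamma : R -> X),
    quasi_geodesic c I gamma -> morse_set kappa (gamma @` I) ->
    forall (x y z : G) (s t u : R),
      I s -> I t -> I u -> s <= t -> t <= u ->
      gamma s = act x o -> gamma t = act z o -> gamma u = act y o ->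
    forall n (P : nat -> G), P 0%N = x -> P n = y ->
      (forall i, (i < n)%N -> (dl (P i) (P i.+1) <= L)%N) ->
      (forall a b, (a <= b <= n)%N -> (b - a <= M * dl (P a) (P b))%N) ->
      exists2 k, (k <= n)%N & (dl z (P k) <= r)%N.
Proof.
move=> kappa0 c1; pose e := kappa (L + M).+2%:R + 1.
have e0 : 0 < e by rewrite ltr_wpDl// kappa0// ler1n.
(* The inner factor bounds |v - v'|, as gamma(v) and gamma(v') are within 2e + L. The upper
   quasi-geodesic bound then gives the distance from gamma(v) to z, and [e] the step from gamma(v)
   to the chain. *)
pose B := c * (c * (2 * e + L%:R + c)) + c + e.
exists (Num.truncn (B + 1)) =>
  I gamma [Iitv gqg] gM x y z s t u Is It Iu st tu gs gt gu n P P0 Pn PL PM.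
have c0 : 0 < c by lra.
have near := morse_near gM PL PM.
rewrite P0 Pn in near; have {}near := near ltac:(by exists s) ltac:(by exists u).
pose left k := exists2 v, I v /\ v <= t & mdist (act (P k) o) (gamma v) < e.
have left0 : left 0%N by exists s => //; rewrite P0 gs mdistxx.
have [a [an [v [Iv vt] av]] ha] := last_index n left0.
have [v' [Iv' tv'] vv'] : exists2 v', I v' /\ t <= v' &
    mdist (gamma v) (gamma v') <= 2 * e + L%:R.
  move: an; rewrite leq_eqVlt => /orP[/eqP an|an].
    exists u => //; rewrite gu -Pn -an metric_sym; have : 0 <= L%:R :> R by [].
    lra.
  have [_ [v' Iv' <-] av'] := near a.+1 an.
  have tv' : t <= v'.
    rewrite leNgt; apply/negP => v't; apply: (ha a.+1); [lia|].
    by exists v' => //; split => //; exact: ltW.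
  exists v' => //.
  have h1 := metric_triangle (gamma v) (act (P a) o) (gamma v').
  have h2 := metric_triangle (act (P a) o) (act (P a.+1) o) (gamma v').
  have h3 := mdist_lt_len o act_geometric (P a) (P a.+1).
  have h4 : (dl (P a) (P a.+1))%:R <= L%:R :> R by rewrite ler_nat PL.
  rewrite metric_sym in av; rewrite -/e in av'; lra.
exists a => //.
have [+ _] := andP (gqg v v' Iv Iv').
rewrite lerBlDr ler_pdivrMl// => h1.
have [_ h2] := andP (gqg v t Iv It).
have h3 : `|v - t| <= `|v - v'| by rewrite !ler0_norm; lra.
have h4 := metric_triangle (act (P a) o) (gamma v) (act z o).
have h5 := len_le_mdist o act_geometric z (P a).
have zB : mdist (act z o) (act (P a) o) <= B.
  rewrite metric_sym -gt in h4 *.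
  have : c * `|v - t| <= c * (c * (2 * e + L%:R + c)).
    rewrite ler_pM2l//; apply: le_trans h3 _; apply: le_trans h1 _.
    by rewrite ler_pM2l// lerD2r.
  rewrite /B; lra.
rewrite truncn_ge_nat; first by apply: le_trans h5 _; rewrite lerD2r.
by rewrite addr_ge0//; apply: le_trans zB; exact: mdist_ge0.
Qed.

End MorseCrossing.

(** * Ancona inequalities *)

Section SpectralGap.
Variables (R : realType) (G : groupType) (mu : G -> R) (S : {fset G}).
Hypothesis mu_ge0 : forall g, 0 <= mu g.
Hypothesis mu_supp : forall g, g \notin S -> mu g = 0.
Hypothesis mu_sum : \sum_(s <- S) mu s = 1.
Hypothesis mu_irr : irreducible mu.

(** A positive transition probability from x to y has a first step s of positive weight followed by
    a positive probability from xs to y. *)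
Lemma support_generates (H : set G) : H 1%g ->
  (forall g h, H g -> H h -> H (g * h)%g) -> (forall s, s \in S -> 0 < mu s -> H s) ->
  H = setT.
Proof.
move=> H1 HM HS; apply/seteqP; split => // y _.
have [n] := mu_irr 1%g y; move: H1; move: (1%g) => x.
elim: n x => [|n ih] x Hx;
  first by rewrite transition0; case: eqP => [<-|_]; rewrite ?ltxx.
rewrite (transitionS mu_supp) => h.
have [s /andP[sS]] : exists s, (s \in S) && (0 < mu s * transition mu n (x * s)%g y).
  apply: contrapT => hn; move: h; rewrite big_seq big1 ?ltxx// => s sS.
  apply/eqP; rewrite eq_le mulr_ge0 ?(transition_ge0 mu_ge0 mu_supp)// andbT leNgt.
  by apply/negP => h; apply: hn; exists s; rewrite sS.
have [m0|m0] := eqVneq (mu s) 0; first by rewrite m0 mul0r ltxx.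
have {}m0 : 0 < mu s by rewrite lt_neqAle eq_sym m0 mu_ge0.
by rewrite pmulr_rgt0// => /ih; apply; apply: HM => //; exact: HS.
Qed.

Lemma energy_ge0 (f : G -> R) : 0 <= energy mu S f.
Proof.
by apply: sumr_ge0 => s _; rewrite mulr_ge0// gsum_ge0// => g; exact: sqr_ge0.
Qed.

(** If no spectral gap existed, the candidates d = (n + 1)^-2 would fail for all n, and the
    functions violating them are the almost invariant vectors of [amenable_of_energy]. *)
Lemma transition_decay : ~ amenable R G ->
  exists A t : R, [/\ 0 < A, 0 < t, t < 1 &
    forall n x y, transition mu n x y <= A * t ^+ n].
Proof.
move=> nam.
have [d [d0 d1 gap]] : exists d : R, [/\ 0 < d, d <= 1 &
    forall f, fsupp f -> d * gsum (fun g => f g ^+ 2) <= energy mu S f].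
  apply: contrapT => hd; apply: nam; apply: (amenable_of_energy (S := S) mu_ge0).
    by move=> H H1 HM _; exact: support_generates.
  move=> n; apply: contrapT => hf; apply: hd; exists (n.+1%:R ^- 2); split.
  - by rewrite invr_gt0 exprn_gt0.
  - by rewrite invf_le1 ?exprn_gt0// exprn_ege1// ler1n.
  - move=> f ff; rewrite ler_pdivrMl ?exprn_gt0// leNgt; apply/negP => h; apply: hf.
    exists f; split => //; last exact: ltW.
    by apply: le_lt_trans h; rewrite mulr_ge0 ?energy_ge0// sqr_ge0.
have [A [t [A0 t0 t1 At]]] := conv_decay mu_ge0 mu_sum d0 d1 gap.
exists A, t; split => // n x y.
by rewrite /transition (convolution_powerE mu_supp).
Qed.

End SpectralGap.

Lemma exists_expr_le (R : realType) (t e : R) : 0 < t -> t < 1 -> 0 < e ->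
  exists n : nat, t ^+ n <= e.
Proof.
move=> t0 t1 e0.
have /cvgr0Pnorm_le/(_ _ e0)[n _ hn] : GRing.exp t @ \oo --> 0.
  by apply: cvg_expr; rewrite gtr0_norm.
by exists n; apply: le_trans (ler_norm _) (hn n (leqnn n)).
Qed.

Lemma exists_pos_lower_bound (R : realType) (I : eqType) (r : seq I) (f : I -> R) :
  (forall i, 0 < f i) ->
  exists e : R, [/\ 0 < e, e <= 1 / 2 & forall i, i \in r -> e <= f i].
Proof.
move=> f0; elim: r => [|i r [e [e0 e1 er]]]; first by exists (1 / 2); split => //; lra.
exists (Num.min e (f i)); split; first by rewrite lt_min e0 f0.
  by rewrite ge_min e1.
move=> j; rewrite inE ge_min => /orP[/eqP ->|/er ->//]; by rewrite lexx orbT.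
Qed.

(** * Green function estimates along Morse quasi-geodesics *)

Section Ancona.
Variables (R : realType) (G : groupType) (mu : G -> R) (S : {fset G}).
Hypothesis mu_ge0 : forall g, 0 <= mu g.
Hypothesis mu_supp : forall g, g \notin S -> mu g = 0.
Hypothesis mu_sum : \sum_(s <- S) mu s = 1.
Variables (A t : R).
Hypothesis A_gt0 : 0 < A.
Hypothesis t_gt0 : 0 < t.
Hypothesis t_lt1 : t < 1.
Hypothesis decay : forall n x y, transition mu n x y <= A * t ^+ n.

Local Notation gr := (gr mu).
Local Notation psum := (psum mu).

(** Summing over n < N turns the convolutions in time into products of Green functions. The middle
    factor counts only times at least [k a b], hence the exponential tail. *)
Lemma psum_union_bound N x y (B V : {fset G}) (k : G -> G -> nat) :
  (forall n w, (n < N)%N -> trajectory S n x w -> nth 1%g w n = y ->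
     (exists2 i, (i <= n)%N & nth 1%g w i \in B) \/
     (exists i j, [/\ (i <= j <= n)%N, nth 1%g w i \in V, nth 1%g w j \in V &
         (k (nth 1%g w i) (nth 1%g w j) <= j - i)%N])) ->
  psum N x y <= \sum_(h <- B) gr x h * gr h y +
     \sum_(a <- V) \sum_(b <- V) gr x a * (A / (1 - t) * t ^+ k a b) * gr b y.
Proof.
move=> hw.
have p0 := psum_ge0 mu_ge0 mu_supp.
have ple := psum_le_gr mu_ge0 mu_supp A_gt0 t_gt0 t_lt1 decay.
have tr0 := transition_ge0 mu_ge0 mu_supp.
have gr0 u v : 0 <= gr u v by apply: le_trans (ple 0%N u v).
have A'0 : 0 <= A / (1 - t) by rewrite divr_ge0 ?subr_ge0 ?ltW.
apply: (@le_trans _ _ (\sum_(0 <= n < N) (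
     \sum_(h <- B) \sum_(0 <= i < n.+1)
       transition mu i x h * transition mu (n - i) h y +
     \sum_(a <- V) \sum_(b <- V) \sum_(0 <= i < n.+1) transition mu i x a *
        \sum_(0 <= m < (n - i).+1) (k a b <= m)%:R * transition mu m a b *
            transition mu (n - i - m) b y))).
  rewrite /psum big_nat [leRHS]big_nat; apply: ler_sum => n /andP[_ nN].
  by apply: (transition_union_bound mu_ge0 mu_supp) => w; exact: hw.
rewrite big_split/=; apply: lerD.
  rewrite exchange_big/=; apply: ler_sum => h _.
  apply: le_trans (cauchy_product_le _ (fun i => tr0 i x h) (fun i => tr0 i h y)) _.
  by apply: ler_pM; rewrite ?p0 ?ple.
rewrite exchange_big/=; apply: ler_sum => a _.
rewrite exchange_big/=; apply: ler_sum => b _.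
pose be m := (k a b <= m)%:R * transition mu m a b.
pose v j := \sum_(0 <= m < j.+1) be m * transition mu (j - m) b y.
have be0 m : 0 <= be m by rewrite mulr_ge0.
have v0 j : 0 <= v j by apply: sumr_ge0 => m _; rewrite mulr_ge0.
apply: le_trans (cauchy_product_le (v := v) _ (fun i => tr0 i x a) v0) _.
rewrite -mulrA; apply: ler_pM; [exact: p0|exact: sumr_ge0|exact: ple|].
apply: le_trans (cauchy_product_le (u := be) _ be0 (fun i => tr0 i b y)) _.
apply: ler_pM; [exact: sumr_ge0|exact: p0| |exact: ple].
apply: le_trans (tail_le A_gt0 t_gt0 t_lt1 decay (k a b) N a b).
rewrite [leRHS]big_mkcond; apply: ler_sum => m _.
by rewrite /be; case: ifP => _; rewrite ?mul1r ?mul0r.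
Qed.

Variables (X : metricType R) (act : G -> X -> X) (o : X).
Hypothesis act_geometric : geometric_action act.
Hypothesis X_proper : proper_space X.
Hypothesis X_geodesic : geodesic_space X.
Hypothesis mu_irr : irreducible mu.

Local Notation len := (len act o).
Local Notation dl p q := (len (p^-1 * q)%g).

(** Follow a chain of [dl x y] bounded increments: finitely many increments occur, each with
    positive probability at some time. The weight 2^-n is included to make the bound summable in
    [sum_exp_len_le]. *)
Lemma transition_lower_bound : exists q : R, [/\ 0 < q, q <= 1 / 2 &
  forall x y, exists n, q ^+ dl x y <= 2 ^- n * transition mu n x y].
Proof.
have [L chain] := len_chain o act_geometric X_geodesic.
pose T := fset_set [set g | (len g <= L)%N].
have /choice[m hm] (g : G) : exists n, 0 < transition mu n 1%g g := mu_irr 1%g g.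
have f0 g : 0 < 2 ^- m g * transition mu (m g) 1%g g
  by rewrite mulr_gt0 ?invr_gt0 ?exprn_gt0.
have [q [q0 q1 qT]] := exists_pos_lower_bound T f0.
exists q; split => // x y; have [f [f_0 fn fL]] := chain x y.
rewrite -{2}fn; elim: (dl x y) => [|i [n hn]].
  by exists 0%N; rewrite f_0 transition0 eqxx expr0 invr1 mulr1.
set s := ((f i)^-1 * f i.+1)%g.
have sT : s \in T.
  rewrite in_fset_set; last exact: finite_len_le.
  by rewrite inE /= fL.
exists (n + m s)%N; rewrite exprSr.
apply: (@le_trans _ _ ((2 ^- n * transition mu n x (f i)) *
    (2 ^- m s * transition mu (m s) 1%g s))).
  by apply: ler_pM; rewrite ?exprn_ge0 ?(ltW q0)// qT.
have := transition_mul_le mu_ge0 mu_supp n (m s) x (f i) (f i.+1).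
have -> : transition mu (m s) (f i) (f i.+1) = transition mu (m s) 1%g s.
  by rewrite -(transition_mulg mu (m s) (f i)^-1%g) mulVg.
by move=> h; rewrite exprD invfM mulrACA ler_wpM2l// mulr_ge0 ?invr_ge0 ?exprn_ge0.
Qed.

(** Each term is at most one of the terms 2^-n p_n(z, g); for fixed n their sum over g is at most
    2^-n. This replaces any count of the points in balls. *)
Lemma sum_exp_len_le (q : R) : 0 < q ->
  (forall x y, exists n, q ^+ dl x y <= 2 ^- n * transition mu n x y) ->
  forall z (V : {fset G}), \sum_(g <- V) q ^+ dl z g <= 2.
Proof.
move=> q0 hq z V; have /choice[m hm] := hq z.
pose N := (\max_(g <- V) m g).+1.
apply: (@le_trans _ _ (\sum_(g <- V) \sum_(0 <= n < N) 2 ^- n * transition mu n z g)).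
  rewrite big_seq [leRHS]big_seq; apply: ler_sum => g gV; apply: le_trans (hm g) _.
  apply: (ler_sum_mem (F := fun n => 2 ^- n * transition mu n z g)) => //.
    by rewrite mem_index_iota /= ltnS leq_bigmax_seq.
  by move=> n; rewrite mulr_ge0 ?invr_ge0 ?exprn_ge0 ?(transition_ge0 mu_ge0 mu_supp).
rewrite exchange_big/=.
apply: (@le_trans _ _ (\sum_(0 <= n < N) (2 : R) ^- n)).
  apply: ler_sum => n _; rewrite -mulr_sumr ler_piMr ?invr_ge0 ?exprn_ge0//.
  exact: (transition_sum_le1 mu_ge0 mu_supp mu_sum).
suff -> : \sum_(0 <= n < N) (2 : R) ^- n = 2 - 2 * 2 ^- N.
  by rewrite lerBlDr lerDl mulr_ge0 ?invr_ge0 ?exprn_ge0.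
elim: (N) => [|n ih]; first by rewrite big_geq// expr0 invr1; lra.
rewrite big_nat_recr//= ih exprS invfM; lra.
Qed.

Lemma tame_path_meets_ball (kappa : R -> R) (c : R) (K L : nat) :
  (forall t : R, 1 <= t -> 0 <= kappa t) -> 1 <= c -> (0 < K)%N -> (0 < L)%N ->
  (forall x y, exists f : nat -> G,
    [/\ f 0%N = x, f (dl x y) = y & forall i, (dl (f i) (f i.+1) <= L)%N]) ->
  exists r : nat, forall (I : set R) (gamma : R -> X),
    quasi_geodesic c I gamma -> morse_set kappa (gamma @` I) ->
    forall (x y z : G) (s t u : R),
      I s -> I t -> I u -> s <= t -> t <= u ->
      gamma s = act x o -> gamma t = act z o -> gamma u = act y o ->
    forall n (w : nat -> G), w 0%N = x -> w n = y ->
      (forall i, (i < n)%N -> (dl (w i) (w i.+1) <= L)%N) ->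
      (forall i j, (i <= j <= n)%N -> (j - i <= K * (dl z (w i) + dl z (w j)))%N) ->
      exists2 i, (i <= n)%N & (dl z (w i) <= r)%N.
Proof.
move=> kappa0 c1 K0 L0 chain.
have [r hr] := morse_chain_meets_ball o act_geometric L (2 * K * L) kappa0 c1.
exists (2 * r)%N => I gamma gq gM x y z s t' u Is It Iu st tu gs gt gu n w w0 wn wL wK.
apply: contrapT => hn.
(* A path avoiding the ball of radius 2r has a detour with 2r + 1 <= 2 d(z, P k), which therefore
   avoids the ball of radius r. *)
have wr i : (i <= n)%N -> ((2 * r).+1 <= dl z (w i))%N.
  by move=> iN; rewrite ltnNge; apply/negP => h; apply: hn; exists i.
have [m [P [P0 Pm PL PM Pr]]] :=
  exists_detour (d := fun p q => dl p q) (fun p q => len_sym o act_geometric p q)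
    (fun p q r => len_triangle o act_geometric p q r) chain L0 K0 wL wK wr.
rewrite w0 in P0; rewrite wn in Pm.
have [k km kr] := hr I gamma gq gM x y z s t' u Is It Iu st tu gs gt gu m P P0 Pm PL PM.
by have /= := Pr k km; rewrite ltn_mul2l /= ltnNge kr.
Qed.

Lemma ancona_inequalities (kappa : R -> R) (c : R) :
  (forall t : R, 1 <= t -> 0 <= kappa t) -> 1 <= c ->
  exists2 C : R, 0 < C & forall (I : set R) (gamma : R -> X),
    quasi_geodesic c I gamma -> morse_set kappa (gamma @` I) ->
    forall (x y z : G) (s t u : R),
      I s -> I t -> I u -> s <= t -> t <= u ->
      gamma s = act x o -> gamma t = act z o -> gamma u = act y o ->
    gr x z * gr z y <= C * gr x y /\ gr x y <= C * (gr x z * gr z y).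
Proof.
move=> kappa0 c1.
have tr0 := transition_ge0 mu_ge0 mu_supp.
have ple := psum_le_gr mu_ge0 mu_supp A_gt0 t_gt0 t_lt1 decay.
have gr0 u v : 0 <= gr u v := gr_ge0 mu_ge0 mu_supp A_gt0 t_gt0 t_lt1 decay u v.
have [q [q0 q1 hq]] := transition_lower_bound.
have qsum := sum_exp_len_le q0 hq.
have qX n : 0 <= q ^+ n by rewrite exprn_ge0// ltW.
have qX0 n : 0 < q ^+ n by rewrite exprn_gt0.
have qle m n : (m <= n)%N -> q ^+ n <= q ^+ m.
  by move=> mn; apply: ler_wiXn2l => //; lra.
have qtr u v : exists n, q ^+ dl u v <= transition mu n u v.
  have [n hn] := hq u v; exists n; apply: le_trans hn _.
  by rewrite ler_piMl// invf_le1 ?exprn_gt0// exprn_ege1// ler1n.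
have qgr u v : q ^+ dl u v <= gr u v.
  have [n hn] := qtr u v; apply: le_trans hn _; apply: le_trans (ple n.+1 u v).
  by rewrite /psum big_nat_recr//= lerDr; apply: sumr_ge0.
set g1 := gr 1%g 1%g.
have g1_ge1 : 1 <= g1 := gr_diag_ge1 mu_ge0 mu_supp A_gt0 t_gt0 t_lt1 decay.
have g1_gt0 : 0 < g1 by lra.
have gmul := gr_mul_le_gr mu_ge0 mu_supp A_gt0 t_gt0 t_lt1 decay.
pose A' := A / (1 - t).
have A'0 : 0 < A' by rewrite divr_gt0// subr_gt0.
(* The three powers of q pay for the lower bound on G(a, b), for the smallness q^r1, and for the
   convergence of the sums over a and b. *)
have [K0 hK0] : exists n, t ^+ n <= q ^+ 3 by apply: exists_expr_le.
pose K := K0.+1.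
have hK : t ^+ K <= q ^+ 3.
  by apply: le_trans hK0; rewrite exprS ler_piMl ?exprn_ge0 ?(ltW t_gt0) ?(ltW t_lt1).
have [L [L_gt0 chain LS]] : exists L : nat, [/\ (0 < L)%N,
    forall u v, exists f : nat -> G,
      [/\ f 0%N = u, f (dl u v) = v & forall i, (dl (f i) (f i.+1) <= L)%N] &
    forall s, s \in S -> (len s <= L)%N].
  have [L0 chain0] := len_chain o act_geometric X_geodesic.
  exists (L0 + \sum_(s <- S) len s + 1)%N; split; first by rewrite addn1.
    move=> u v; have [f [f0 fn fL]] := chain0 u v; exists f; split => // i.
    by apply: leq_trans (fL i) _; rewrite -addnA leq_addr.
  by move=> s sS; rewrite (big_rem s)//= addnCA -addnA leq_addr.
have [r hr] := tame_path_meets_ball kappa0 c1 (ltn0Sn K0) L_gt0 chain.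
have D0 : 0 < 8 * A' * g1 ^+ 2.
  by apply: mulr_gt0; [exact: mulr_gt0|exact: exprn_gt0].
(* This choice makes the contribution of the trajectories that avoid the ball at most half of G(x,
   y). *)
have [R1 hR1] : exists n, q ^+ n <= (8 * A' * g1 ^+ 2)^-1.
  by apply: exists_expr_le => //; [lra|rewrite invr_gt0].
pose r1 := (r + R1)%N.
(* The first term is twice the constant of the claim [H] below, after half of G(x, y) has been
   absorbed; [g1] serves the other inequality. *)
exists (4 * q ^- (3 * r1) + g1).
  by rewrite addr_gt0// mulr_gt0// invr_gt0.
move=> I gamma gq gM x y z s t' u Is It Iu st tu gs gt gu.
have gxz := gr0 x z; have gzy := gr0 z y; have gxy := gr0 x y.
have gg := mulr_ge0 gxz gzy.
have iq : 0 < q ^- (3 * r1) by rewrite invr_gt0.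
split.
  by apply: le_trans (gmul x z y) _; rewrite ler_wpM2r// lerDr mulr_ge0 ?ltW.
suff H N : psum N x y <= 2 * q ^- (3 * r1) * (gr x z * gr z y) + 1 / 2 * gr x y.
  have : gr x y <= 2 * q ^- (3 * r1) * (gr x z * gr z y) + 1 / 2 * gr x y.
    by apply: (gr_le mu_ge0 mu_supp A_gt0 t_gt0 t_lt1 decay).
  have := mulr_ge0 (ltW g1_gt0) gg; lra.
pose B := fset_set [set h | (dl z h <= r1)%N].
(* In fewer than N steps the walk stays within L N + 1 of x, so the finite set [V] contains all its
   positions outside [B]. *)
pose V := fset_set [set h | (dl x h <= L * N + 1)%N /\ (r1 < dl z h)%N].
have fin_ball p n : finite_set [set h | (dl p h <= n)%N].
  apply: sub_finite_set
    (finite_image (fun g => p * g)%g (finite_len_le o act_geometric X_proper n)).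
  by move=> h /= hn; exists (p^-1 * h)%g => //; rewrite mulVKg.
have BE h : (h \in B) = (dl z h <= r1)%N
  by rewrite in_fset_set//; apply/idP/idP; rewrite inE.
have VE h : (h \in V) = (dl x h <= L * N + 1)%N && (r1 < dl z h)%N.
  rewrite in_fset_set; last by apply: sub_finite_set (fin_ball x (L * N + 1)%N) => ? [].
  by apply/idP/andP; rewrite inE.
have ub := @psum_union_bound N x y B V (fun a b => K * (dl z a + dl z b))%N _.
apply: le_trans (ub _) _.
  (* A trajectory avoiding [B] lies in [V]; were it tame, it would enter the ball of radius r, which
     is contained in [B]. *)
  move=> n w nN [sw w0 wS] wy.
  have [hB|hB] := pselect (exists2 i, (i <= n)%N & nth 1%g w i \in B); first by left.
  right; apply: contrapT => hV; apply: hB.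
  have wL i : (i < n)%N -> (dl (nth 1%g w i) (nth 1%g w i.+1) <= L)%N.
    by move=> /wS/LS.
  have wB i : (i <= n)%N -> (dl z (nth 1%g w i) <= r1)%N || (nth 1%g w i \in V).
    move=> iN; have [//|ri] := boolP (dl z (nth 1%g w i) <= r1)%N.
    rewrite VE ltnNge ri andbT -w0.
    apply: leq_trans (chain_dist_refl (d := fun p q => dl p q)
      (fun p q r => len_triangle o act_geometric p q r) _ wL (b := i) _) _ => //.
      by move=> p; rewrite mulVg len1.
    by rewrite subn0 leq_add2r leq_mul2l (leq_trans iN (ltnW nN)) orbT.
  apply: contrapT => hB.
  have wV i : (i <= n)%N -> nth 1%g w i \in V.
    move=> iN; have /orP[h|//] := wB i iN.
    by exfalso; apply: hB; exists i => //; rewrite BE.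
  have [i iN ir] : exists2 i, (i <= n)%N & (dl z (nth 1%g w i) <= r)%N.
    apply: (hr I gamma gq gM x y z s t' u Is It Iu st tu gs gt gu n
      (fun i => nth 1%g w i)) => //.
    move=> i j ijn; have /andP[ij jn] := ijn.
    rewrite leqNgt; apply/negP => h; apply: hV; exists i, j.
    by split; [|exact: wV (leq_trans ij jn)|exact: wV|exact: ltnW].
  by apply: hB; exists i => //; rewrite BE (leq_trans ir)// /r1 leq_addr.
apply: lerD.
  (* Two factors q^-r1 move h to z in the two Green functions; the third makes q^(dl z h) q^-r1 at
     least 1, so that the sum over [B] is controlled by [qsum]. *)
  apply: (@le_trans _ _
    (\sum_(h <- B) q ^+ dl z h * (q ^- (3 * r1) * (gr x z * gr z y)))).
    rewrite big_seq [leRHS]big_seq; apply: ler_sum => h; rewrite BE => hB.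
    have e1 : q ^+ r1 * gr x h <= gr x z.
      have [n hn] := qtr h z;
        apply: le_trans (gr_shift_le mu_ge0 mu_supp A_gt0 t_gt0 t_lt1 decay n x h z).
      rewrite mulrC ler_wpM2l//; apply: le_trans hn; apply: qle.
      by rewrite (len_sym o act_geometric).
    have e2 : q ^+ r1 * gr h y <= gr z y.
      have [n hn] := qtr z h;
        apply: le_trans (gr_shift_ge mu_ge0 mu_supp A_gt0 t_gt0 t_lt1 decay n z h y).
      by rewrite ler_wpM2r//; apply: le_trans hn; apply: qle.
    have e3 : q ^+ (3 * r1) = q ^+ r1 * (q ^+ r1 * q ^+ r1)
      by rewrite -!exprD addnn -mul2n -mulSn.
    rewrite mulrCA ler_pdivlMl// e3.
    have -> : q ^+ r1 * (q ^+ r1 * q ^+ r1) * (gr x h * gr h y) =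
       q ^+ r1 * ((q ^+ r1 * gr x h) * (q ^+ r1 * gr h y)) by ring.
    by apply: ler_pM; rewrite ?mulr_ge0// ?qle//; apply: ler_pM; rewrite ?mulr_ge0.
  rewrite -mulr_suml -mulrA; apply: ler_wpM2r; last exact: qsum.
  by rewrite mulr_ge0// ltW.
apply: (@le_trans _ _ (\sum_(a <- V) \sum_(b <- V)
   q ^+ dl z a * (q ^+ dl z b * (A' * q ^+ r1 * (g1 * (g1 * gr x y)))))).
  rewrite big_seq [leRHS]big_seq; apply: ler_sum => a; rewrite VE => /andP[_ aR].
  rewrite big_seq [leRHS]big_seq; apply: ler_sum => b; rewrite VE => /andP[_ bR].
  set ra := dl z a in aR *; set rb := dl z b in bR *.
  (* Of the three powers q^(ra + rb), one is kept for the summation, one is at most q^r1 since [a]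
     lies outside the ball, and one is at most G(a, b) by the triangle inequality. *)
  have e1 : t ^+ (K * (ra + rb)) <= q ^+ ra * q ^+ rb * q ^+ r1 * gr a b.
    rewrite exprM; apply: (@le_trans _ _ ((q ^+ 3) ^+ (ra + rb))).
      by apply: lerXn2r; rewrite ?nnegrE ?exprn_ge0// ltW.
    have -> : (q ^+ 3) ^+ (ra + rb) =
      q ^+ ra * q ^+ rb * q ^+ (ra + rb) * q ^+ (ra + rb).
      by rewrite -exprD -!exprMn; congr (_ ^+ _); ring.
    apply: ler_pM; rewrite ?mulr_ge0//.
      by rewrite ler_wpM2l ?mulr_ge0// qle// (leq_trans (ltnW aR))// leq_addr.
    apply: le_trans (qgr a b); apply: qle.
    by rewrite /ra (len_sym o act_geometric z a) (len_triangle o act_geometric).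
  have e2 : gr x a * gr a b * gr b y <= g1 * (g1 * gr x y).
    apply: (@le_trans _ _ (g1 * gr x b * gr b y)).
      by apply: ler_wpM2r => //; exact: gmul.
    by rewrite -mulrA; apply: ler_wpM2l; [exact: ltW|exact: gmul].
  apply: (@le_trans _ _
    (gr x a * (A' * (q ^+ ra * q ^+ rb * q ^+ r1 * gr a b)) * gr b y)).
    apply: ler_wpM2r => //; apply: ler_wpM2l => //; apply: ler_wpM2l => //; exact: ltW.
  have -> : gr x a * (A' * (q ^+ ra * q ^+ rb * q ^+ r1 * gr a b)) * gr b y =
     q ^+ ra * (q ^+ rb * (A' * q ^+ r1 * (gr x a * gr a b * gr b y))) by ring.
  do 2 (apply: ler_wpM2l => //); apply: ler_wpM2l => //.
  by rewrite mulr_ge0// ltW.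
set W := A' * q ^+ r1 * (g1 * (g1 * gr x y)).
have W0 : 0 <= W.
  apply: mulr_ge0; first by apply: mulr_ge0 => //; exact: ltW.
  by do 2 (apply: mulr_ge0; first exact: ltW).
(* The double sum is at most 2 * 2 * W by [qsum], hence at most half of G(x, y). *)
have W1 : 8 * W <= gr x y.
  have -> : 8 * W = (8 * A' * g1 ^+ 2) * q ^+ r1 * gr x y by rewrite /W; ring.
  rewrite ler_piMl// mulrC -ler_pdivlMr//.
  by rewrite mul1r; apply: le_trans hR1; apply: qle; rewrite /r1 leq_addl.
apply: (@le_trans _ _ (2 * (2 * W))); last lra.
under eq_bigr do rewrite -mulr_sumr -mulr_suml.
have q_ge0 : 0 <= \sum_(b <- V) q ^+ dl z b by apply: sumr_ge0.
rewrite -mulr_suml; apply: ler_pM => //; first exact: mulr_ge0.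
exact: ler_wpM2r.
Qed.

End Ancona.

Theorem corollary1p11 (R : realType) (G : groupType) (X : metricType R)
    (act : G -> X -> X) (o : X) (mu : G -> R)
    (G_fg : finitely_generated G)
    (G_nonamenable : ~ amenable R G)
    (X_proper : proper_space X)
    (X_geodesic : geodesic_space X)
    (act_geometric : geometric_action act)
    (mu_prob : fsupp_probability mu)
    (mu_irr : irreducible mu)
    (kappa : R -> R) (kappa_ge0 : forall t : R, 1 <= t -> 0 <= kappa t)
    (c : R) (c_ge1 : 1 <= c) :
  exists2 C : R, 0 < C &
    forall (I : set R) (gamma : R -> X),
      quasi_geodesic c I gamma ->
      morse_set kappa (gamma @` I) ->
      forall (x y z : G) (s t u : R),
        I s -> I t -> I u -> s <= t -> t <= u ->
        gamma s = act x o -> gamma t = act z o -> gamma u = act y o ->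
        ((C^-1)%:E * (green mu x z * green mu z y) <= green mu x y)%E /\
        (green mu x y <= C%:E * (green mu x z * green mu z y))%E.
Proof.
have [mu_ge0 mu_fin mu_sum] := mu_prob.
pose S := fset_set [set g | mu g != 0].
have mu_supp g : g \notin S -> mu g = 0.
  by rewrite in_fset_set// => gS; apply/eqP; apply: contraNT gS => g0; rewrite inE.
have S_sum : \sum_(s <- S) mu s = 1 by rewrite -mu_sum (fsbigTE S).
have [A [t [A0 t0 t1 decay]]] :=
  transition_decay mu_ge0 mu_supp S_sum mu_irr G_nonamenable.
have [C C0 HC] := ancona_inequalities mu_ge0 mu_supp S_sum A0 t0 t1 decay o
  act_geometric X_proper X_geodesic mu_irr kappa_ge0 c_ge1.
exists C => // I gamma gq gM x y z s t' u Is It Iu st tu gs gt gu.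
have [h1 h2] := HC I gamma gq gM x y z s t' u Is It Iu st tu gs gt gu.
(* All Green functions here are finite, so the extended inequalities reduce to the real ones. *)
rewrite !(greenE mu_ge0 mu_supp A0 t0 t1 decay) -!EFinM !lee_fin.
by split; rewrite ?ler_pdivrMl.
Qed.
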